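(* For any partition $\lambda$ of $n$, the lifted HL function satisfies $$\mathbf{P}_\lambda(t)=\sum_{\lambda(\pi)=\lambda}\mathbf{P}_\pi(t),$$ the sum being over set partitions $\pi\vdash[n]$ with $\lambda(\pi)=\lambda$. Consequently, when $t=0$, $$\mathbf{S}_\lambda=\sum_{\lambda(\pi)=\lambda}\mathbf{s}_\pi=\sum_{\mu\le\lambda}\ \sum_{\lambda(\pi)=\mu}K_{\lambda\mu}(t)\,\mathbf{P}_\pi(t).$$ Moreover, $\mathbf{S}_{(n)}=\mathbf{h}_{[n]}$ and $\mathbf{S}_{(1^n)}=\mathbf{e}_{[n]}$. If $\lambda$ is a partition with distinct parts, then $$\mathbf{P}_\lambda(-1)=\sum_{\lambda(\pi)=\lambda}\mathbf{P}_\pi(-1)=\sum_{\mu}g_{\lambda\mu}\,\mathbf{S}_\mu,$$ where $g_{\lambda\mu}=[s_\mu]P_\lambda(-1)$ is the coefficient of the Schur function $s_\mu$ in the Schur expansion of the classical Schur $P$-function $P_\lambda(-1)$.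
   Context: Set partitions. A set partition $\pi=\pi_1/\cdots/\pi_l\vdash[n]$ is a set of disjoint nonempty blocks with union $[n]$; $\lambda(\pi)$ is the partition of $n$ listing the block sizes in weakly decreasing order. A permutation $\delta\in\mathfrak{S}_n$ acts by $\delta\pi=\delta(\pi_1)/\cdots/\delta(\pi_l)$. For a partition $\mu=(\mu_1,\ldots,\mu_l)\vdash n$, $[\mu]$ is the set partition of $[n]$ whose blocks are the consecutive intervals $\{1,\ldots,\mu_1\},\{\mu_1+1,\ldots,\mu_1+\mu_2\},\ldots$. The permutation $\delta_\pi\in\mathfrak{S}_n$ is given in one-line notation by listing the blocks of $\pi$ in weakly decreasing size, blocks of equal size in increasing order of smallest element, the elements of each block in increasing order, and erasing the bars; thus $\pi=\delta_\pi[\lambda(\pi)]$. For a partition $\mu=(\mu_1,\ldots,\mu_l)=\langle 1^{m_1}2^{m_2}\cdots\rangle$ put $\mu!=\mu_1!\cdots\mu_l!$ and $\mu^!=m_1!m_2!\cdots$; for a set partition $\sigma$ put $\sigma!=\lambda(\sigma)!$. The order $\le$ on partitions of $n$ is dominance order. Noncommuting variables $\mathbf{x}=(\mathbf{x}_1,\mathbf{x}_2,\ldots)$. A permutation $\delta\in\mathfrak{S}_n$ acts by $\delta\circ(\mathbf{x}_{i_1}\cdots\mathbf{x}_{i_n})=\mathbf{x}_{i_{\delta^{-1}(1)}}\cdots\mathbf{x}_{i_{\delta^{-1}(n)}}$, extended linearly. For $\pi\vdash[n]$, $\mathbf{m}_\pi=\sum\mathbf{x}_{i_1}\cdots\mathbf{x}_{i_n}$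 over tuples of positive integers with $i_a=i_b$ iff $a,b$ are in the same block of $\pi$; $\mathbf{e}_\pi=\sum\mathbf{x}_{i_1}\cdots\mathbf{x}_{i_n}$ over tuples with $i_a\ne i_b$ whenever $a\neq b$ are in the same block of $\pi$; and $\mathbf{h}_\pi=\sum_{\sigma\vdash[n]}(\sigma\wedge\pi)!\,\mathbf{m}_\sigma$, where $\sigma\wedge\pi$ is the greatest lower bound in the refinement order (its blocks are the nonempty intersections of blocks of $\sigma$ and $\pi$). Here $\mathbf{h}_{[n]},\mathbf{e}_{[n]}$ are indexed by the one-block set partition of $[n]$. HL functions. $P_\lambda(t)$ is the classical Hall-Littlewood symmetric function in commuting variables, $c_{\lambda\mu}(t)\in\mathbb{Z}[t]$ are defined by $P_\lambda(t)=\sum_{\mu\le\lambda}c_{\lambda\mu}(t)m_\mu$, and the Kostka polynomials $K_{\lambda\mu}(t)$ by $s_\lambda=\sum_{\mu\le\lambda}K_{\lambda\mu}(t)P_\mu(t)$. For $\pi\vdash[n]$ with $\lambda(\pi)=\lambda$, $$\mathbf{P}_\pi(t)=\sum_{\mu\le\lambda}\frac{c_{\lambda\mu}(t)}{\mu^!}\sum_{g\in G_\pi}g\circ\mathbf{m}_{\delta_\pi[\mu]},\qquad G_\pi=\{\delta\in\mathfrak{S}_n:\delta\pi=\pi\},$$ and $\mathbf{s}_\pi=\mathbf{P}_\pi(0)$. For a partition $\lambda$, the lifted HL function is $$\mathbf{P}_\lambda(t)=\sum_{\mu\le\lambda}\mu!\,c_{\lambda\mu}(t)\sum_{\lambda(\sigma)=\mu}\mathbf{m}_\sigma,$$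 and the lifted Schur function is $\mathbf{S}_\lambda=\mathbf{P}_\lambda(0)$. *)

(* Defs.v *)
From HB Require Import structures.
From Stdlib Require Import ClassicalEpsilon.
From mathcomp Require Import all_boot all_order all_fingroup all_algebra.
From mathcomp Require Import mpoly.

Set Implicit Arguments.
Unset Strict Implicit.
Unset Printing Implicit Defensive.

Import GRing.Theory.

Local Open Scope ring_scope.

Definition is_intpart (n : nat) (s : seq nat) : bool :=
  [&& sorted geq s, all (leq 1) s & sumn s == n].

Record intpart (n : nat) : predArgType :=
  IntPart { parts :> seq nat; _ : is_intpart n parts }.

HB.instance Definition _ n := [isSub for @parts n].
HB.instance Definition _ n := [Countable of intpart n by <:].

Lemma intpartP n (lam : intpart n) : is_intpart n lam.
Proof. exact: valP. Qed.

Lemma size_is_intpart n s : is_intpart n s -> (size s <= n)%N.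
Proof.
case/and3P=> _ + /eqP<-; elim: s => //= a s IHs /andP[a_gt0 /IHs].
by rewrite -addn1 addnC => /(leq_add a_gt0).
Qed.

Lemma mem_is_intpart n s k : is_intpart n s -> k \in s -> (k <= n)%N.
Proof.
case/and3P=> _ _ /eqP<-; elim: s => //= a s IHs.
rewrite inE => /predU1P[->|/IHs/leq_trans]; first exact: leq_addr.
by apply; apply: leq_addl.
Qed.

Definition intpart_code n (lam : intpart n) : n.-bseq 'I_n.+1 :=
  insub_bseq n [seq inord k | k <- lam].

Definition intpart_decode n (b : n.-bseq 'I_n.+1) : option (intpart n) :=
  insub [seq val k | k <- b].

Lemma intpart_codeK n : pcancel (@intpart_code n) (@intpart_decode n).
Proof.
move=> lam; rewrite /intpart_decode /intpart_code.
have lamP := intpartP lam.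
rewrite /insub_bseq insubdK; last by rewrite -topredE /= size_map size_is_intpart.
rewrite -map_comp map_id_in ?valK // => k /(mem_is_intpart lamP) le_kn /=.
by rewrite inordK.
Qed.

HB.instance Definition _ n :=
  isFinite.Build (intpart n) (pcan_enumP (@intpart_codeK n)).

Definition dominated (n : nat) (mu lam : intpart n) : bool :=
  [forall k : 'I_n.+1, (sumn (take k mu) <= sumn (take k lam))%N].

Definition prod_fact (s : seq nat) : nat := (\prod_(k <- s) k`!)%N.

Definition mult_fact (s : seq nat) : nat :=
  (\prod_(k <- undup s) (count_mem k s)`!)%N.

Lemma row_part_subproof n : is_intpart n (nseq (0 < n) n).
Proof. by case: n => //= n; rewrite /is_intpart /= addn0 eqxx. Qed.

(* The partition (n); it is empty when n = 0. *)
Definition row_part n : intpart n := IntPart (row_part_subproof n).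

Lemma col_part_subproof n : is_intpart n (nseq n 1%N).
Proof.
rewrite /is_intpart sumn_nseq mul1n eqxx andbT all_nseq orbT andbT.
by elim: n => [|[]].
Qed.

Definition col_part n : intpart n := IntPart (col_part_subproof n).

(* [n] is represented by 'I_n = {0, ..., n-1}. *)

Record setpart (n : nat) : predArgType :=
  SetPart { blocks :> {set {set 'I_n}}; _ : partition blocks [set: 'I_n] }.

HB.instance Definition _ n := [isSub for @blocks n].
HB.instance Definition _ n := [Finite of setpart n by <:].

Lemma setpartP n (pi : setpart n) : partition pi [set: 'I_n].
Proof. by case: pi. Qed.

Definition block_sizes (n : nat) (P : {set {set 'I_n}}) : seq nat :=
  sort geq [seq #|B| | B : {set 'I_n} <- enum P].

Lemma sp_type_subproof n (pi : setpart n) : is_intpart n (block_sizes pi).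
Proof.
have piP := setpartP pi; apply/and3P; split.
- by apply: sort_sorted => a b; rewrite /geq /= leq_total.
- rewrite all_sort; apply/allP => k /mapP[B]; rewrite mem_enum => piB ->.
  by rewrite card_gt0 (partition_neq0 piP piB).
- have /perm_sumn-> := permEl (perm_sort geq [seq #|B| | B : {set 'I_n} <- enum pi]).
  by rewrite sumnE big_map big_enum /= -(card_partition piP) cardsT card_ord.
Qed.

Definition sp_type n (pi : setpart n) : intpart n := IntPart (sp_type_subproof pi).

Definition same_block n (P : {set {set 'I_n}}) (a b : 'I_n) : bool :=
  [exists B in P, (a \in B) && (b \in B)].

Definition perm_act n (d : 'S_n) (P : {set {set 'I_n}}) : {set {set 'I_n}} :=
  [set d @: B | B : {set 'I_n} in P].

Definition sp_meet n (P Q : {set {set 'I_n}}) : {set {set 'I_n}} :=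
  [set A :&: B | A in P, B in Q] :\ set0.

(* The set partition [mu] into consecutive intervals. *)
Definition interval_blocks n (mu : intpart n) : {set {set 'I_n}} :=
  [set [set i : 'I_n | (sumn (take j mu) <= i < sumn (take j.+1 mu))%N]
     | j : 'I_(size mu)].

(* The one-block partition of [n] (the empty partition when n = 0). *)
Definition one_block n : {set {set 'I_n}} := [set [set: 'I_n]] :\ set0.

Definition block_min n (B : {set 'I_n}) : nat := (\big[minn/n]_(i in B) i)%N.

Definition block_before n (A B : {set 'I_n}) : bool :=
  (#|B| < #|A|)%N || (#|A| == #|B|) && (block_min A <= block_min B)%N.

(* The one-line notation of delta_pi; [enum B] is increasing. *)
Definition delta_word n (P : {set {set 'I_n}}) : seq 'I_n :=
  flatten [seq enum B | B : {set 'I_n} <- sort (@block_before n) (enum P)].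

Lemma delta_word_count n (pi : setpart n) (x : 'I_n) :
  count_mem x (delta_word pi) = 1%N.
Proof.
have piP := setpartP pi; rewrite /delta_word count_flatten -map_comp.
have /(perm_map (count_mem x \o (fun B : {set 'I_n} => enum B)))/perm_sumn-> :=
  permEl (perm_sort (@block_before n) (enum pi)).
rewrite sumnE big_map big_enum /=.
have cov : x \in cover pi by rewrite (cover_partition piP) inE.
have tI := partition_trivIset piP.
rewrite (bigD1 (pblock pi x)) ?pblock_mem //= big1 => [|B /andP[piB neqB]].
  by rewrite addn0 count_uniq_mem ?enum_uniq // mem_enum mem_pblock cov.
rewrite count_uniq_mem ?enum_uniq // mem_enum.
by case: (boolP (x \in B)) => // xB; rewrite (def_pblock tI piB xB) eqxx in neqB.
Qed.

Lemma delta_word_uniq n (pi : setpart n) : uniq (delta_word pi).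
Proof.
apply: count_mem_uniq => x; rewrite delta_word_count.
by rewrite -has_pred1 has_count delta_word_count.
Qed.

Lemma delta_word_size n (pi : setpart n) : size (delta_word pi) = n.
Proof.
rewrite -(card_uniqP (delta_word_uniq pi)) -[RHS]card_ord.
by apply: eq_card => x; rewrite -has_pred1 has_count delta_word_count.
Qed.

Lemma delta_subproof n (pi : setpart n) :
  injective (fun i : 'I_n => nth i (delta_word pi) i).
Proof.
move=> i j /eqP; rewrite (set_nth_default i j) ?delta_word_size //.
by rewrite nth_uniq ?delta_word_size ?delta_word_uniq // => /eqP/val_inj.
Qed.

Definition delta n (pi : setpart n) : 'S_n := perm (@delta_subproof n pi).

(* An element of the ring of symmetric functions (an inverse limit over the
   number of variables) is given by its images in m variables, for every m. *)

Definition ratfun (R : idomainType) (m : nat) := {fraction {mpoly R[m]}}.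

(* The distinct rearrangements, in N^m, of lam padded with zeros. *)
Definition rearr n m (lam : intpart n) : {set {ffun 'I_m -> 'I_n.+1}} :=
  [set a : {ffun 'I_m -> 'I_n.+1} |
     perm_eq [seq k <- [seq val (a i) | i <- enum 'I_m] | (0 < k)%N] lam].

Definition monom n (R : idomainType) (lam : intpart n) (m : nat) : ratfun R m :=
  \sum_(a in rearr m lam) \prod_(i < m) tofrac ('X_i ^+ a i : {mpoly R[m]}).

(* Macdonald's formula P_lam(x_1, ..., x_m; t) =
     \sum_(w in S_m / S_m^lam) w (x^lam \prod_(lam_i > lam_j)
                                          (x_i - t x_j) / (x_i - x_j)),
   the cosets being indexed by the rearrangements a = w lam. *)
Definition hall_littlewood n (R : idomainType) (t : R) (lam : intpart n)
    (m : nat) : ratfun R m :=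
  \sum_(a in rearr m lam)
     (\prod_(i < m) tofrac ('X_i ^+ a i : {mpoly R[m]}))
     * \prod_(i < m) \prod_(j < m | (a j < a i)%N)
          (tofrac ('X_i - t *: 'X_j : {mpoly R[m]})
           / tofrac ('X_i - 'X_j : {mpoly R[m]})).

(* The bialternant det(x_i^(lam_j + m - j)) / det(x_i^(m - j)). *)
Definition schur n (R : idomainType) (lam : intpart n) (m : nat) : ratfun R m :=
  if (size lam <= m)%N then
    tofrac (\det (\matrix_(i < m, j < m)
      ('X_i ^+ (nth 0%N lam j + (m - j.+1)) : {mpoly R[m]})))
    / tofrac (\det (\matrix_(i < m, j < m)
      ('X_i ^+ (m - j.+1) : {mpoly R[m]})))
  else 0.

(* [is_expansion S b f c] says that f = \sum_(mu | S mu) c_mu b_mu in the ring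
   of symmetric functions; [coords S b f] is the family c of coefficients in
   the expansion of f, and is unspecified outside S. *)
Definition is_expansion n (R : idomainType) (S : pred (intpart n))
    (b : intpart n -> forall m, ratfun R m) (f : forall m, ratfun R m)
    (c : intpart n -> R) : Prop :=
  forall m : nat,
    f m = \sum_(mu : intpart n | S mu) tofrac (mpolyC m (c mu)) * b mu m.

Definition coords n (R : idomainType) (S : pred (intpart n))
    (b : intpart n -> forall m, ratfun R m) (f : forall m, ratfun R m) :
    intpart n -> R :=
  epsilon (inhabits (fun _ => 0)) (is_expansion S b f).

(* c_{lam mu}(t), with t = 'X; meaningful for mu <= lam. *)
Definition hl_coef n (lam mu : intpart n) : {poly int} :=
  coords (fun nu => dominated nu lam) (@monom n {poly int})
    (hall_littlewood 'X lam) mu.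

(* K_{lam mu}(t), with t = 'X; meaningful for mu <= lam. *)
Definition kostka n (lam mu : intpart n) : {poly int} :=
  coords (fun nu => dominated nu lam) (@hall_littlewood n {poly int} 'X)
    (schur {poly int} lam) mu.

(* g_{lam mu} = [s_mu] P_lam(-1) *)
Definition schurP_coef n (lam mu : intpart n) : int :=
  coords predT (@schur n int) (hall_littlewood (-1 : int) lam) mu.

(* The word w stands for the monomial x_(w 0) ... x_(w (n-1)); the variables
   are indexed by nat (from 0).  A homogeneous formal series of degree n is
   given by its coefficient at every word. *)

Definition word (n : nat) := {ffun 'I_n -> nat}.

Definition ncseries (A : Type) (n : nat) := word n -> A.

(* The place action sends the word i to j, with j_a = i_(d^-1 a), so the
   coefficient of j in d o F is that of i in F, where i_a = j_(d a). *)
Definition nc_act (A : Type) n (d : 'S_n) (F : ncseries A n) : ncseries A n :=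
  fun j => F [ffun a => j (d a)].

Definition nc_m (A : nzRingType) n (P : {set {set 'I_n}}) : ncseries A n :=
  fun w => if [forall a, forall b, (w a == w b) == same_block P a b]
           then 1 else 0.

Definition nc_e (A : nzRingType) n (P : {set {set 'I_n}}) : ncseries A n :=
  fun w => if [forall a, forall b, (a != b) && same_block P a b ==> (w a != w b)]
           then 1 else 0.

Definition nc_h (A : nzRingType) n (P : {set {set 'I_n}}) : ncseries A n :=
  fun w => \sum_(sigma : setpart n)
    (prod_fact (block_sizes (sp_meet sigma P)))%:R * nc_m A sigma w.

Definition polyQ (p : {poly int}) : {poly rat} := map_poly intr p.

Definition nc_at n (F : ncseries {poly rat} n) (a : rat) : ncseries rat n :=
  fun w => (F w).[a].

Definition stab_group n (pi : setpart n) : {set 'S_n} :=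
  [set d : 'S_n | perm_act d pi == pi].

(* P_pi(t), indexed by a set partition, as opposed to [lifted_HL] below. *)
Definition nc_HL n (pi : setpart n) : ncseries {poly rat} n :=
  fun w => \sum_(mu : intpart n | dominated mu (sp_type pi))
    ((mult_fact mu)%:R^-1 *: polyQ (hl_coef (sp_type pi) mu))
    * \sum_(g in stab_group pi)
        nc_act g (nc_m _ (perm_act (delta pi) (interval_blocks mu))) w.

Definition nc_schur n (pi : setpart n) : ncseries rat n := nc_at (nc_HL pi) 0.

Definition lifted_HL n (lam : intpart n) : ncseries {poly rat} n :=
  fun w => \sum_(mu : intpart n | dominated mu lam)
    ((prod_fact mu)%:R *: polyQ (hl_coef lam mu))
    * \sum_(sigma : setpart n | sp_type sigma == mu) nc_m _ sigma w.

Definition lifted_schur n (lam : intpart n) : ncseries rat n :=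
  nc_at (lifted_HL lam) 0.

(* Main.v *)
(** Multiplying Macdonald's formula for P_lam(x_1, ..., x_m; t) by the
    Vandermonde product gives an alternating polynomial whose exponents are
    dominated, in the order given by partial sums, by lam + delta, the
    coefficient there being 1.  An alternating polynomial of the right degree
    is determined by its coefficients at the exponents mu + delta, and at
    t = 1 these polynomials are the Vandermonde multiples of the monomial
    symmetric functions; so inverting a unitriangular matrix yields, for
    m >= n, a unitriangular expansion of P_lam over Z[t].  Setting x_m = 0
    shows that the coefficients do not depend on m.  At t = 0 the formula
    becomes the bialternant, by extracting from the Vandermonde determinant of
    the x_i y^(a_i) its leading coefficient in y; for the partition (n) it
    becomes the partial fraction expansion of h_n.

    On the noncommutative side, the elements g delta_pi, for pi of type lam
    and g in G_pi, run once through S_n, so the sum of the P_pi(t) is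
    governed by the number mu! mu^! of permutations mapping [mu] to a given
    set partition of type mu. *)

From Stdlib Require Import ClassicalEpsilon.
From mathcomp Require Import all_boot all_order all_fingroup all_algebra.
From mathcomp Require Import mpoly zify.
Require Import Defs.

Set Implicit Arguments.
Unset Strict Implicit.
Unset Printing Implicit Defensive.

Import GRing.Theory.

Local Open Scope ring_scope.

(** * Products over pairs and unitriangular systems *)

(** [hl_coef], [kostka] and [schurP_coef] are chosen by [epsilon] among the expansions valid in
    every number of variables. Nothing is known of them until one expansion is exhibited whose
    coefficients are common to all [m]; this forces the stability argument. Clearing the Vandermonde
    denominator turns the question into one about polynomials, where finitely many coefficients
    decide. The expansion is used for generic [t] over [{poly int}] and pushed along ring morphisms
    to [t = 0] and [t = -1]. Comparing alternating polynomials requires that [x = - x] force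
    [x = 0]. The lift is linear: it sends [m_mu] to [mu!] times the sum of the [m_sigma] with
    [sigma] of type [mu]. A classical identity therefore transfers as soon as it is stated for
    monomial coefficients, which is the form given to the identities for [K] and [g]. *)

Lemma big_ltn_pairs (R : Type) (idx : R) (op : Monoid.com_law idx) m
    (G : 'I_m -> 'I_m -> R) :
  (forall i, G i i = idx) ->
  \big[op/idx]_(i < m) \big[op/idx]_(j < m) G i j =
  \big[op/idx]_(i < m) \big[op/idx]_(j < m | (i < j)%N) op (G i j) (G j i).
Proof.
move=> G1; transitivity (op
    (\big[op/idx]_(i < m) (\big[op/idx]_(j < m | (i < j)%N) G i j))
    (\big[op/idx]_(i < m) (\big[op/idx]_(j < m | (j < i)%N) G i j))).
  rewrite -big_split; apply: eq_bigr => i _ /=.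
  rewrite (bigID (fun j : 'I_m => (i < j)%N)) /=; congr (op _ _).
  rewrite (bigD1 i) ?ltnn //= G1 Monoid.mul1m; apply: eq_bigl => j.
  by rewrite -leqNgt ltn_neqAle andbC.
rewrite [X in op _ X](exchange_big_dep predT) //= -big_split /=.
by apply: eq_bigr => i _; rewrite -big_split.
Qed.

(** The sign collects the inversions of [s^-1] and is the same for every antisymmetric [f], so it
    can be evaluated on one convenient [f]. *)
Lemma prod_perm_alternating_signE (R : comPzRingType) m (s : 'S_m)
    (f : 'I_m -> 'I_m -> R) :
  (forall i j, f j i = - f i j) ->
  \prod_(i < m) \prod_(j < m | (i < j)%N) f (s i) (s j) =
  (\prod_(i < m) \prod_(j < m | (i < j)%N)
     (if (s^-1%g i < s^-1%g j)%N then 1 else -1)) *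
  \prod_(i < m) \prod_(j < m | (i < j)%N) f i j.
Proof.
move=> fN; pose G i j := if (s^-1%g i < s^-1%g j)%N then f i j else 1.
transitivity (\prod_(i < m) \prod_(j < m) G i j).
  rewrite [RHS](reindex_inj (@perm_inj _ s)) /=; apply: eq_bigr => i _.
  rewrite [RHS](reindex_inj (@perm_inj _ s)) /= big_mkcond.
  by apply: eq_bigr => j _; rewrite /G !permK.
rewrite big_ltn_pairs => [|i]; last by rewrite /G ltnn.
rewrite -big_split; apply: eq_bigr => i _; rewrite -big_split.
apply: eq_bigr => j ltij; rewrite /G /=; case: ltngtP => [_|_|eqij].
- by rewrite mulr1 mul1r.
- by rewrite mul1r fN mulN1r.
- have E : i = j by apply: (@perm_inj _ (s^-1)%g); apply: val_inj.
  by rewrite E ltnn in ltij.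
Qed.

(** The sign is identified in [int], on differences of the nodes 0, ..., m-1: their product is a
    nonzero Vandermonde determinant, and permuting its columns multiplies it by the sign of [s]. The
    canonical map from [int] carries the result to [R]. *)
Lemma prod_perm_alternating (R : comPzRingType) m (s : 'S_m)
    (f : 'I_m -> 'I_m -> R) :
  (forall i j, f j i = - f i j) ->
  \prod_(i < m) \prod_(j < m | (i < j)%N) f (s i) (s j) =
  (-1) ^+ s * \prod_(i < m) \prod_(j < m | (i < j)%N) f i j.
Proof.
move=> fN; rewrite prod_perm_alternating_signE //; congr (_ * _).
pose E : int := \prod_(i < m) \prod_(j < m | (i < j)%N)
   (if (s^-1%g i < s^-1%g j)%N then 1 else -1).
suff ES : E = (-1) ^+ s.
  transitivity (E%:~R : R); last by rewrite ES rmorphXn rmorphN1.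
  rewrite rmorph_prod; apply: eq_bigr => i _; rewrite rmorph_prod.
  by apply: eq_bigr => j _; case: ifP; rewrite ?rmorphN1.
pose a : 'rV[int]_m := \row_i (i : nat)%:Z.
have nz : \prod_(i < m) \prod_(j < m | (i < j)%N) (a 0 j - a 0 i) != 0.
  apply/prodf_neq0 => i _; apply/prodf_neq0 => j ltij.
  by rewrite !mxE subr_eq0; apply/eqP => -[E1]; rewrite E1 ltnn in ltij.
apply: (mulIf nz).
rewrite -(@prod_perm_alternating_signE _ _ s (fun i j => a 0 j - a 0 i));
  last by move=> i j; rewrite opprB.
transitivity (\det (Vandermonde m (\row_i a 0 (s i)))).
  rewrite det_Vandermonde; apply: eq_bigr => i _; apply: eq_bigr => j _.
  by rewrite !mxE.
rewrite -det_Vandermonde mulrC -[s in RHS]invgK odd_permV -det_perm -det_mulmx.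
by rewrite -col_permE; congr (\det _); apply/matrixP => i j; rewrite !mxE.
Qed.

Lemma big_ltn_rev (R : comPzRingType) m (f : 'I_m -> 'I_m -> R) :
  \prod_(i < m) \prod_(j < m | (i < j)%N) f (rev_ord j) (rev_ord i) =
  \prod_(i < m) \prod_(j < m | (i < j)%N) f i j.
Proof.
rewrite [RHS](reindex_inj rev_ord_inj) /=.
under [RHS]eq_bigr => i _ do rewrite (reindex_inj rev_ord_inj) /=.
rewrite [RHS](exchange_big_dep predT) //=; apply: eq_bigr => i _.
apply: eq_bigl => j; have := ltn_ord i; have := ltn_ord j; lia.
Qed.

(** Up to transposition this is the usual Vandermonde matrix of the reversed variables, with rows
    and columns both reversed; the two signs cancel. *)
Lemma det_Vandermonde_rev (R : comPzRingType) m (x : 'I_m -> R) :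
  \det (\matrix_(i < m, j < m) x i ^+ (m - j.+1)) =
  \prod_(i < m) \prod_(j < m | (i < j)%N) (x i - x j).
Proof.
rewrite -big_ltn_rev.
transitivity (\det (Vandermonde m (\row_i x (rev_ord i)))); last first.
  rewrite det_Vandermonde; apply: eq_bigr => i _; apply: eq_bigr => j _.
  by rewrite !mxE.
pose s : 'S_m := perm (@rev_ord_inj m).
transitivity (\det (row_perm s (col_perm s (Vandermonde m (\row_i x (rev_ord i)))))).
  rewrite -[LHS]det_tr; congr (\det _); apply/matrixP => i j.
  by rewrite !mxE !permE /= rev_ordK.
rewrite row_permE col_permE !det_mulmx !det_perm odd_permV mulrCA -signr_addb.
by rewrite addbb mulr1.
Qed.

(** Elimination from the top: on a down-closed set containing the support of [f], subtracting
    [f x0 * F x0 mu] for a maximal [x0] kills the value at [x0] and keeps the support inside the set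
    without [x0]. *)
Lemma unitriangular_solve (T : finType) (R : comPzRingType) (le : rel T)
    (F : T -> T -> R) :
  reflexive le -> antisymmetric le -> transitive le ->
  (forall nu mu, F nu mu != 0 -> le mu nu) -> (forall mu, F mu mu = 1) ->
  forall (lam : T) (f : T -> R), (forall mu, f mu != 0 -> le mu lam) ->
  exists c : T -> R,
    [/\ forall mu, ~~ le mu lam -> c mu = 0, c lam = f lam
      & forall mu, f mu = \sum_(nu | le nu lam) c nu * F nu mu].
Proof.
move=> le_refl le_anti le_trans Fle F1 lam f fle.
suff [c cP fE] : exists2 c : T -> R, forall mu, ~~ le mu lam -> c mu = 0
    & forall mu, f mu = \sum_nu c nu * F nu mu.
  exists c; split=> // [|mu]; last first.
    rewrite fE (bigID (fun nu => le nu lam)) /= [X in _ + X]big1 ?addr0 //.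
    by move=> nu /cP->; rewrite mul0r.
  rewrite fE (bigD1 lam) //= F1 mulr1 big1 ?addr0 // => nu neq.
  have [lenu|/cP->] := boolP (le nu lam); last by rewrite mul0r.
  have [->|/Fle le2] := eqVneq (F nu lam) 0; first by rewrite mulr0.
  by case/eqP: neq; apply: le_anti; rewrite lenu le2.
pose dn (S : {set T}) := forall mu nu, nu \in S -> le mu nu -> mu \in S.
suff main (S : {set T}) : dn S -> forall f : T -> R,
    (forall mu, mu \notin S -> f mu = 0) ->
    exists2 c : T -> R, forall mu, mu \notin S -> c mu = 0
    & forall mu, f mu = \sum_nu c nu * F nu mu.
  have [mu nu||c cP fE] := main [set mu | le mu lam] _ f.
  - by rewrite !inE => le1 le2; apply: le_trans le1.
  - by move=> mu; rewrite inE; apply: contraNeq => /fle.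
  - by exists c => // mu nle; apply: cP; rewrite inE.
move: {2}#|S|.+1 (ltnSn #|S|) => N; elim: N S => // N IHN S; rewrite ltnS => leSN.
move=> dnS {fle}f0 f0P; have [S0|[x xS]] := set_0Vmem S.
  exists (fun _ => 0) => // mu; rewrite f0P ?S0 ?inE // big1 // => nu _.
  by rewrite mul0r.
(* An element with the fewest elements of [S] above it is maximal in [S]. *)
pose up y := #|[set z in S | le y z]|.
have [x0 x0S' x0min] := arg_minnP up xS; have x0S : x0 \in S := x0S'.
have x0max y : y \in S -> le x0 y -> y = x0.
  move=> yS le0y; apply/esym/eqP; apply: contraT => neq.
  have : (up y < up x0)%N.
    apply: proper_card; apply/properP; split.
      by apply/subsetP => z; rewrite !inE => /andP[->] /(le_trans _ _ _ le0y).
    exists x0; first by rewrite inE x0S le_refl.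
    rewrite inE x0S /=; apply: contra neq => leyx; apply/eqP/le_anti.
    by rewrite le0y leyx.
  by rewrite ltnNge x0min.
have [||mu muS|c cP cE] := IHN (S :\ x0) _ _ (fun mu => f0 mu - f0 x0 * F x0 mu).
- by move: leSN; rewrite (cardsD1 x0 S) x0S.
- move=> mu nu; rewrite !inE => /andP[neq nuS] lemn.
  rewrite (dnS _ _ nuS lemn) andbT; apply: contra neq => /eqP eqx.
  by rewrite eqx in lemn; rewrite (x0max _ nuS lemn).
- have [->|neq] := eqVneq mu x0; first by rewrite F1 mulr1 subrr.
  have nmuS : mu \notin S by move: muS; rewrite !inE neq.
  rewrite f0P // sub0r; have [->|/Fle le2] := eqVneq (F x0 mu) 0.
    by rewrite mulr0 oppr0.
  by rewrite (dnS _ _ x0S le2) in nmuS.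
exists (fun mu => c mu + f0 x0 * (mu == x0)%:R) => mu.
  move=> nmuS; rewrite cP ?inE ?(negPf nmuS) ?andbF //.
  have [eqx|_] := eqVneq mu x0; last by rewrite mulr0 addr0.
  by rewrite eqx x0S in nmuS.
under eq_bigr => nu _ do rewrite mulrDl.
rewrite big_split /= -cE (bigD1 x0) //= eqxx mulr1 big1 ?addr0 ?subrK //.
by move=> nu /negPf->; rewrite mulr0 mul0r.
Qed.

(** * Integer partitions and rearrangements *)

Lemma geq_trans : transitive geq.
Proof. by move=> y x z /= le1 le2; apply: leq_trans le2 le1. Qed.

Lemma geq_anti : antisymmetric geq.
Proof. by move=> x y; rewrite /= -eqn_leq => /eqP. Qed.

Lemma geq_total : total geq.
Proof. by move=> x y; apply: leq_total. Qed.

Lemma intpart_sumn n (lam : intpart n) : sumn lam = n.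
Proof. by have /and3P[_ _ /eqP] := intpartP lam. Qed.

Lemma intpart_sorted n (lam : intpart n) : sorted geq lam.
Proof. by have /and3P[] := intpartP lam. Qed.

Lemma intpart_size n (lam : intpart n) : (size lam <= n)%N.
Proof. exact: size_is_intpart (intpartP lam). Qed.

Lemma intpart_nth_gt0 n (lam : intpart n) k :
  (0 < nth 0%N lam k)%N = (k < size lam)%N.
Proof.
have [lt|ge] := ltnP k (size lam); last by rewrite nth_default.
by have /and3P[_ /allP + _] := intpartP lam; apply; apply: mem_nth.
Qed.

Lemma intpart_nth_leq n (lam : intpart n) k l :
  (k <= l)%N -> (nth 0%N lam l <= nth 0%N lam k)%N.
Proof.
move=> lekl; have [ge|lt] := leqP (size lam) l; first by rewrite nth_default.
apply: (sorted_leq_nth geq_trans leqnn 0%N (intpart_sorted lam)) => //.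
by rewrite inE; apply: leq_ltn_trans lt.
Qed.

Lemma intpart_nth_bound n (lam : intpart n) k : (nth 0%N lam k < n.+1)%N.
Proof.
have [lt|ge] := ltnP k (size lam); last by rewrite nth_default.
by rewrite ltnS (mem_is_intpart (intpartP lam)) ?mem_nth.
Qed.

Lemma intpart_eq n (lam mu : intpart n) :
  (forall k, nth 0%N lam k = nth 0%N mu k) -> lam = mu.
Proof.
move=> E; apply: val_inj; apply: (@eq_from_nth _ 0%N) => // .
have H k : (k < size lam)%N = (k < size mu)%N by rewrite -!intpart_nth_gt0 E.
apply/eqP; rewrite eqn_leq leqNgt H ltnn /= leqNgt -H ltnn //.
Qed.

Lemma sumn_takeE (s : seq nat) k : sumn (take k s) = (\sum_(i < k) nth 0%N s i)%N.
Proof.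
elim: k s => [|k IHk] [|a s]; rewrite ?take0 ?big_ord0 //=.
  by rewrite big1 // => i _; rewrite nth_nil.
by rewrite big_ord_recl IHk.
Qed.

(** [dominated] tests only [k <= n]; beyond that both partial sums equal [n], a partition of [n]
    having at most [n] parts. *)
Lemma dominatedP n (mu lam : intpart n) :
  reflect (forall k, (\sum_(i < k) nth 0%N mu i <= \sum_(i < k) nth 0%N lam i)%N)
    (dominated mu lam).
Proof.
apply: (iffP forallP) => [H k|H k]; last by rewrite !sumn_takeE.
have [lekn|ltnk] := leqP k n.
  by have := H (Ordinal (lekn : (k < n.+1)%N)); rewrite !sumn_takeE.
rewrite -!sumn_takeE !take_oversize ?intpart_sumn //.
  exact: leq_trans (intpart_size lam) (ltnW ltnk).
exact: leq_trans (intpart_size mu) (ltnW ltnk).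
Qed.

Lemma dominated_refl n : reflexive (@dominated n).
Proof. by move=> mu; apply/dominatedP. Qed.

Lemma dominated_trans n : transitive (@dominated n).
Proof.
move=> nu mu lam /dominatedP H1 /dominatedP H2; apply/dominatedP => k.
exact: leq_trans (H1 k) (H2 k).
Qed.

Lemma dominated_anti n : antisymmetric (@dominated n).
Proof.
move=> mu lam /andP[/dominatedP H1 /dominatedP H2].
have E k : (\sum_(i < k) nth 0%N mu i = \sum_(i < k) nth 0%N lam i)%N.
  by apply/eqP; rewrite eqn_leq H1 H2.
apply: intpart_eq => k; have := E k.+1; rewrite !big_ord_recr /= E.
by move/addnI.
Qed.

(** The default value of [nth] pads [lam] with zeros. The bound on [size lam] belongs to the
    equivalence because [nth] would silently truncate a partition with more than [m] parts. *)
Lemma rearrP n m (lam : intpart n) (a : {ffun 'I_m -> 'I_n.+1}) :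
  reflect ((size lam <= m)%N /\
           exists s : 'S_m, forall i, a i = nth 0%N lam (s i) :> nat)
    (a \in rearr m lam).
Proof.
pose v := [tuple val (a i) | i < m].
pose w := [seq nth 0%N lam i | i <- iota 0 m].
have wE : (size lam <= m)%N -> w = lam ++ nseq (m - size lam) 0%N.
  move=> le; apply: (@eq_from_nth _ 0%N).
    by rewrite size_map size_iota size_cat size_nseq subnKC.
  move=> i; rewrite size_map size_iota => lti.
  rewrite (nth_map 0%N) ?size_iota // nth_iota // nth_cat.
  by case: ltnP => // ge; rewrite nth_nseq if_same nth_default.
have filtE : (size lam <= m)%N -> [seq k <- w | (0 < k)%N] = lam.
  move=> le; rewrite wE // filter_cat (_ : filter _ (nseq _ _) = [::]) ?cats0.
    by apply/all_filterP; have /and3P[] := intpartP lam.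
  by apply/eqP; rewrite -(negbK (_ == _)) -has_filter has_nseq andbF.
have permE : (exists s : 'S_m, forall i, a i = nth 0%N lam (s i) :> nat)
    <-> perm_eq v w.
  have ws : size w == m by rewrite size_map size_iota.
  split=> [[s sE]|pe]; last have /tuple_permP[s sE] : perm_eq v (Tuple ws) := pe.
    rewrite -[w]/(tval (Tuple ws)); apply/tuple_permP; exists s.
    apply/(@eq_from_nth _ 0%N); rewrite ?size_tuple // => i lti.
    rewrite -[i]/(val (Ordinal lti)) -!tnth_nth !tnth_mktuple (tnth_nth 0%N) /=.
    by rewrite (nth_map 0%N) ?size_iota // nth_iota // sE.
  exists s => i; have := congr1 (fun t => nth 0%N t i) sE.
  rewrite -!tnth_nth !tnth_mktuple (tnth_nth 0%N) /=.
  by rewrite (nth_map 0%N) ?size_iota // nth_iota.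
have vE : [seq val (a i) | i <- enum 'I_m] = v by rewrite /= -map_comp.
rewrite inE vE; apply: (iffP idP) => [pe|[le /permE pe]].
  have szv : size v = m by rewrite size_tuple.
  have le : (size lam <= m)%N.
    by rewrite -(perm_size pe) -[in leqRHS]szv size_filter count_size.
  split=> //; apply/permE; rewrite wE //.
  (* The positive entries of [v] are settled by [pe]; the others are zeros, and the length [m]
     dictates their number. *)
  rewrite -(perm_filterC (fun k => 0 < k)%N v).
  apply: perm_cat => //; set u := filter _ _.
  have -> : (m - size lam = size u)%N.
    have sub_add x y z : (x + y = z -> z - x = y)%N by lia.
    rewrite -(perm_size pe) /u !size_filter; apply: sub_add.
    exact: etrans (count_predC _ v) szv.
  suff /all_pred1P-> : all (pred1 0%N) u by rewrite size_nseq.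
  by apply/allP => k; rewrite mem_filter /= lt0n negbK => /andP[].
by rewrite -[X in perm_eq _ X](filtE le); apply: perm_filter.
Qed.

Lemma rearr_size n m (lam : intpart n) (a : {ffun 'I_m -> 'I_n.+1}) :
  a \in rearr m lam -> (size lam <= m)%N.
Proof. by case/rearrP. Qed.

Lemma rearr_perm n m (lam : intpart n) (s : 'S_m)
    (a : {ffun 'I_m -> 'I_n.+1}) :
  ([ffun i => a (s i)] \in rearr m lam) = (a \in rearr m lam).
Proof.
have H (b : {ffun 'I_m -> 'I_n.+1}) (u : 'S_m) :
    b \in rearr m lam -> [ffun i => b (u i)] \in rearr m lam.
  case/rearrP=> le [v vE]; apply/rearrP; split=> //; exists (u * v)%g => i.
  by rewrite ffunE permM vE.
apply/idP/idP; last exact: H.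
move/(H _ (s^-1)%g); set b := finfun _; suff -> : b = a by [].
by apply/ffunP => i; rewrite !ffunE permKV.
Qed.

Definition intpart_vec n m (lam : intpart n) : {ffun 'I_m -> 'I_n.+1} :=
  [ffun i : 'I_m => Ordinal (intpart_nth_bound lam i)].

Lemma rearr_vec n m (lam mu : intpart n) : (size mu <= m)%N ->
  (intpart_vec m mu \in rearr m lam) = (mu == lam).
Proof.
move=> lem; apply/idP/eqP => [|<-]; last first.
  by apply/rearrP; split=> //; exists 1%g => i; rewrite ffunE perm1.
rewrite inE => pe; apply: val_inj.
apply: (sorted_eq geq_trans); try exact: intpart_sorted.
  by move=> a b; rewrite /= -eqn_leq => /eqP.
apply: perm_trans pe; rewrite perm_sym.
have -> : [seq val (intpart_vec m mu i) | i <- enum 'I_m] =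
    mu ++ nseq (m - size mu) 0%N.
  apply: (@eq_from_nth _ 0%N).
    by rewrite size_map size_enum_ord size_cat size_nseq subnKC.
  move=> i; rewrite size_map size_enum_ord => lti.
  rewrite (nth_map (Ordinal lti)) ?size_enum_ord // ffunE /= nth_enum_ord //.
  by rewrite nth_cat; case: ltnP => // ge; rewrite nth_nseq if_same nth_default.
rewrite filter_cat (_ : filter _ (nseq _ _) = [::]) ?cats0.
  by rewrite (all_filterP _) //; have /and3P[] := intpartP mu.
by apply/eqP; rewrite -(negbK (_ == _)) -has_filter has_nseq andbF.
Qed.

(** Exchange argument: the elements of [A] past [k] have values at most [f k], the places before [k]
    missing from [A] have values at least [f k], and the latter are at least as numerous. *)
Lemma sum_nonincreasing_leq m (f : nat -> nat) (A : {set 'I_m}) k :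
  (forall i j, (i <= j)%N -> (f j <= f i)%N) -> (#|A| <= k)%N -> (k <= m)%N ->
  (\sum_(i in A) f i <= \sum_(i < m | (i < k)%N) f i)%N.
Proof.
move=> fle leAk lekm; pose B := [set i : 'I_m | (i < k)%N].
have cB : #|B| = k.
  rewrite cardE /B -[RHS](size_iota 0) -(size_map val) /=.
  apply/perm_size/uniq_perm; rewrite ?iota_uniq ?map_inj_uniq ?enum_uniq //.
    exact: val_inj.
  move=> i; rewrite mem_iota add0n /=; apply/mapP/idP => [[j]|lti].
    by rewrite mem_enum inE => ltj ->.
  by exists (Ordinal (leq_trans lti lekm)); rewrite // mem_enum inE.
under [leqRHS]eq_bigl => i
  do rewrite -[(i < k)%N](in_set (fun i : 'I_m => (i < k)%N)) -/B.
rewrite (big_setID B) [leqRHS](big_setID A) /= setIC leq_add2l.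
apply: (@leq_trans (\sum_(i in B :\: A) f k)%N); last first.
  by apply: leq_sum => i; rewrite !inE => /andP[_ /ltnW/fle].
apply: (@leq_trans (\sum_(i in A :\: B) f k)%N).
  by apply: leq_sum => i; rewrite !inE -leqNgt => /andP[/fle].
rewrite !sum_nat_const leq_mul2r !cardsD setIC cB leq_sub2r ?orbT //.
Qed.

Lemma rearr_psum n m (lam : intpart n) (a : {ffun 'I_m -> 'I_n.+1}) k :
  a \in rearr m lam -> (k <= m)%N ->
  (\sum_(i < m | (i < k)%N) a i <= \sum_(i < k) nth 0%N lam i)%N.
Proof.
case/rearrP => lem [s sE] lekm; rewrite (big_ord_widen m) //.
pose A := s @: [set i : 'I_m | (i < k)%N].
have -> : (\sum_(i < m | (i < k)%N) a i = \sum_(i in A) nth 0%N lam i)%N.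
  rewrite big_imset /=; last by move=> i j _ _ /perm_inj.
  by apply: eq_big => i; rewrite ?inE // sE.
apply: sum_nonincreasing_leq => //; first by move=> i j; apply: intpart_nth_leq.
rewrite card_imset; last exact: perm_inj.
by rewrite cardsE -sum1_card -(big_ord_widen m (fun=> 1%N)) // sum1_card card_ord.
Qed.

Lemma intpart_sum n (lam : intpart n) k : (size lam <= k)%N ->
  (\sum_(i < k) nth 0%N lam i = n)%N.
Proof. by move=> le; rewrite -sumn_takeE take_oversize ?intpart_sumn. Qed.

Lemma rearr_sum n m (lam : intpart n) (a : {ffun 'I_m -> 'I_n.+1}) :
  a \in rearr m lam -> (\sum_(i < m) a i = n)%N.
Proof.
case/rearrP => lem [s sE]; rewrite -[RHS](intpart_sum lem).
by rewrite [RHS](reindex_inj (@perm_inj _ s)); apply: eq_bigr => i _; rewrite sE.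
Qed.

(** * Numerators of Hall-Littlewood functions *)

Definition expo n m (a : {ffun 'I_m -> 'I_n.+1}) : 'X_{1..m} :=
  [multinom (a i : nat) | i < m].

Definition intpart_mnm n m (lam : intpart n) : 'X_{1..m} :=
  [multinom nth 0%N lam i | i < m].

Definition staircase m : 'X_{1..m} := [multinom (m - i.+1)%N | i < m].

Definition vdm (R : comNzRingType) m : {mpoly R[m]} :=
  \prod_(i < m) \prod_(j < m | (i < j)%N) ('X_i - 'X_j).

(** Divided by ['X_i - 'X_j], this is what the unordered pair of places contributes to Macdonald's
    formula. A pair with equal entries contributes 1, so there the numerator repeats the
    denominator. *)
Definition hl_factor n (R : comNzRingType) m (t : R)
    (a : {ffun 'I_m -> 'I_n.+1}) (i j : 'I_m) :
    {mpoly R[m]} :=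
  if (a j < a i)%N then 'X_i - t *: 'X_j
  else if (a i < a j)%N then t *: 'X_i - 'X_j else 'X_i - 'X_j.

(* The numerator of [hall_littlewood t lam m] over the Vandermonde product. *)
Definition hl_num n (R : comNzRingType) (t : R) (lam : intpart n) m :
    {mpoly R[m]} :=
  \sum_(a in rearr m lam) 'X_[expo a] *
     \prod_(i < m) \prod_(j < m | (i < j)%N) hl_factor t a i j.

Definition monom_poly n (R : comNzRingType) (lam : intpart n) m : {mpoly R[m]} :=
  \sum_(a in rearr m lam) 'X_[expo a].

Lemma hl_factorN n (R : comNzRingType) m (t : R)
    (a : {ffun 'I_m -> 'I_n.+1}) (i j : 'I_m) :
  hl_factor t a j i = - hl_factor t a i j.
Proof. by rewrite /hl_factor; case: ltngtP; rewrite opprB. Qed.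

Lemma mpolyX_sub_neq0 (R : idomainType) m (i j : 'I_m) : i != j ->
  'X_i - 'X_j != 0 :> {mpoly R[m]}.
Proof.
move=> neq; apply/eqP => /(congr1 (mcoeff U_(i)%MM)) /eqP.
by rewrite mcoeffB !mcoeffXU eqxx [j == i]eq_sym (negPf neq) subr0 mcoeff0 oner_eq0.
Qed.

Lemma vdm_neq0 (R : idomainType) m : vdm R m != 0.
Proof.
apply/prodf_neq0 => i _; apply/prodf_neq0 => j ltij.
by apply: mpolyX_sub_neq0; rewrite neq_ltn ltij.
Qed.

Lemma monomE n (R : idomainType) (lam : intpart n) m :
  monom R lam m = tofrac (monom_poly R lam m).
Proof.
rewrite rmorph_sum; apply: eq_bigr => a _ /=.
rewrite mpolyXE_id rmorph_prod; apply: eq_bigr => i _.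
by rewrite mnmE.
Qed.

Lemma hall_littlewoodE n (R : idomainType) (t : R) (lam : intpart n) m :
  hall_littlewood t lam m = tofrac (hl_num t lam m) / tofrac (vdm R m).
Proof.
rewrite rmorph_sum mulr_suml; apply: eq_bigr => a _ /=.
rewrite [tofrac (_ * _)]rmorphM -mulrA; congr (_ * _).
  rewrite mpolyXE_id rmorph_prod; apply: eq_bigr => i _.
  by rewrite mnmE.
under eq_bigr => i _ do rewrite big_mkcond /=.
rewrite big_ltn_pairs => [|i]; last by rewrite ltnn.
rewrite /vdm 2!rmorph_prod; rewrite -prodf_div /=; apply: eq_bigr => i _.
rewrite 2!rmorph_prod; rewrite -prodf_div /=; apply: eq_bigr => j ltij.
have neq : i != j by rewrite neq_ltn ltij.
have nz : tofrac ('X_i - 'X_j : {mpoly R[m]}) != 0.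
  by rewrite tofrac_eq0 mpolyX_sub_neq0.
rewrite /hl_factor; case: ltngtP => _; rewrite ?mulr1 ?mul1r ?divff //.
by rewrite -(opprB 'X_i 'X_j) -(opprB (t *: 'X_i) 'X_j) !rmorphN /= invrN mulrNN.
Qed.

Lemma hl_num1 n (R : comNzRingType) (lam : intpart n) m :
  hl_num 1 lam m = vdm R m * monom_poly R lam m.
Proof.
rewrite mulrC mulr_suml; apply: eq_bigr => a _; congr (_ * _).
apply: eq_bigr => i _; apply: eq_bigr => j _.
by rewrite /hl_factor !scale1r; case: ltngtP.
Qed.

Lemma map_hl_num n (R S : comNzRingType) (f : {rmorphism R -> S}) (t : R)
    (lam : intpart n) m :
  map_mpoly f (hl_num t lam m) = hl_num (f t) lam m.
Proof.
rewrite rmorph_sum; apply: eq_bigr => a _ /=; rewrite rmorphM /= map_mpolyX.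
congr (_ * _); rewrite rmorph_prod; apply: eq_bigr => i _ /=.
rewrite rmorph_prod; apply: eq_bigr => j _ /=; rewrite /hl_factor.
by case: ltngtP => _; rewrite rmorphB /= ?map_mpolyZ !map_mpolyX.
Qed.

Lemma map_vdm (R S : comNzRingType) (f : {rmorphism R -> S}) m :
  map_mpoly f (vdm R m) = vdm S m.
Proof.
rewrite rmorph_prod; apply: eq_bigr => i _ /=.
rewrite rmorph_prod; apply: eq_bigr => j _ /=.
by rewrite rmorphB /= !map_mpolyX.
Qed.

Lemma map_monom_poly n (R S : comNzRingType) (f : {rmorphism R -> S})
    (lam : intpart n) m :
  map_mpoly f (monom_poly R lam m) = monom_poly S lam m.
Proof. by rewrite rmorph_sum; apply: eq_bigr => a _ /=; rewrite map_mpolyX. Qed.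

(** * Supports bounded in dominance order *)

Definition psum m (k : nat) (M : 'X_{1..m}) := (\sum_(i < m | (i < k)%N) M i)%N.

Lemma psumD m k (M N : 'X_{1..m}) : psum k (M + N)%MM = (psum k M + psum k N)%N.
Proof. by rewrite /psum -big_split; apply: eq_bigr => i _; rewrite mnmDE. Qed.

Lemma psum1 m k (i : 'I_m) : psum k U_(i)%MM = (i < k)%N.
Proof.
rewrite /psum big_mkcond (bigD1 i) //= big1 => [|j neq].
  by rewrite mnm1E eqxx addn0; case: (_ < _)%N.
by rewrite mnm1E eq_sym (negPf neq) if_same.
Qed.

Lemma psum_inj m (M N : 'X_{1..m}) :
  (forall k, (k <= m)%N -> psum k M = psum k N) -> M = N.
Proof.
move=> E; apply/mnmP => i.
have S (K : 'X_{1..m}) : psum i.+1 K = (psum i K + K i)%N.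
  rewrite /psum (bigD1 i) //= addnC; congr (_ + _)%N; apply: eq_bigl => j.
  by rewrite ltnS [in RHS]ltn_neqAle andbC.
have := E _ (ltn_ord i); rewrite !S E; last exact: ltnW.
by move/addnI.
Qed.

(** Dominance of exponents in the given order of the variables. It is only a bound on the support:
    the coefficient at [M] may vanish and is tracked separately. *)
Definition domlead (R : nzRingType) m (p : {mpoly R[m]}) (M : 'X_{1..m}) : Prop :=
  forall K, p@_K != 0 ->
    mdeg K = mdeg M /\ forall k, (k <= m)%N -> (psum k K <= psum k M)%N.

Lemma domleadX (R : nzRingType) m (M : 'X_{1..m}) : domlead ('X_[M] : {mpoly R[m]}) M.
Proof. by move=> K; rewrite mcoeffX; have [<-|_] := eqVneq M K; rewrite ?eqxx. Qed.

Lemma domlead_sum (R : nzRingType) m (I : Type) (r : seq I) (P : pred I)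
    (F : I -> {mpoly R[m]}) M :
  (forall i, P i -> domlead (F i) M) -> domlead (\sum_(i <- r | P i) F i) M.
Proof.
move=> H; elim/big_ind: _ => // [K|p q Hp Hq K]; first by rewrite mcoeff0 eqxx.
rewrite mcoeffD; have [pK|/Hp//] := eqVneq p@_K 0.
by rewrite pK add0r => /Hq.
Qed.

(** Partial sums are additive, so exponents below [M] and [N] that add up to [M + N] attain every
    partial sum and are [M] and [N] themselves: a single term of the product contributes to the
    coefficient there. *)
Lemma domleadM (R : idomainType) m (p q : {mpoly R[m]}) M N :
  domlead p M -> domlead q N ->
  domlead (p * q) (M + N)%MM /\ (p * q)@_(M + N) = p@_M * q@_N.
Proof.
move=> Hp Hq; split=> [K|].
  rewrite mcoeffM => nz.
  have [x [y [-> xy0]]] : exists x y, K = (x + y)%MM /\ p@_x * q@_y != 0.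
    case: (pickP [pred x : 'X_{1..m < (mdeg K).+1, (mdeg K).+1} |
             (K == (x.1 + x.2)%MM) && (p@_x.1 * q@_x.2 != 0)]).
      by move=> x /= /andP[/eqP E nz1]; exists x.1, x.2.
    move=> H; rewrite big1 ?eqxx // in nz => x Kx; apply/eqP.
    by have := H x; rewrite /= Kx => /negbFE.
  have [|dx px] := Hp x; first by apply: contraNneq xy0 => ->; rewrite mul0r.
  have [|dy py] := Hq y; first by apply: contraNneq xy0 => ->; rewrite mulr0.
  by rewrite !mdegD dx dy; split=> // k le; rewrite !psumD leq_add ?px ?py.
rewrite mcoeffM.
have dM : (mdeg M < (mdeg (M + N)%MM).+1)%N by rewrite mdegD ltnS leq_addr.
have dN : (mdeg N < (mdeg (M + N)%MM).+1)%N by rewrite mdegD ltnS leq_addl.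
rewrite (bigD1 (BMultinom dM, BMultinom dN)) //= big1 ?addr0 // => -[x y] /=.
move=> /andP[/eqP E neq]; apply/eqP; rewrite mulf_eq0; apply: contraNT neq.
rewrite negb_or => /andP[/Hp[_ px] /Hq[_ py]].
have xM : x = M :> 'X_{1..m}.
  apply: psum_inj => k le; have := congr1 (psum k) E; rewrite !psumD.
  by have := px k le; have := py k le; lia.
have yN : y = N :> 'X_{1..m} by apply: (@addmI _ M); apply: etrans (esym E); rewrite xM.
by rewrite xpair_eqE !bmeqP /= xM yN !eqxx.
Qed.

Lemma domlead_prod (R : idomainType) m (I : Type) (r : seq I) (P : pred I)
    (F : I -> {mpoly R[m]}) (M : I -> 'X_{1..m}) :
  (forall i, P i -> domlead (F i) (M i)) ->
  domlead (\prod_(i <- r | P i) F i) (\sum_(i <- r | P i) M i)%MM /\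
  (\prod_(i <- r | P i) F i)@_(\sum_(i <- r | P i) M i) =
     \prod_(i <- r | P i) (F i)@_(M i).
Proof.
move=> H; elim: r => [|i r [IH1 IH2]].
  by rewrite !big_nil; split; [rewrite -mpolyX0; apply: domleadX|rewrite mcoeff1 eqxx].
rewrite !big_cons; case: ifP => // Pi.
by have [D ->] := domleadM (H i Pi) IH1; rewrite IH2.
Qed.

(** For [i < j] the exponent of ['X_i] dominates that of ['X_j], whichever of the two carries the
    parameter [t]. *)
Lemma hl_factor_domlead n (R : idomainType) m (t : R)
    (a : {ffun 'I_m -> 'I_n.+1}) (i j : 'I_m) :
  (i < j)%N -> domlead (hl_factor t a i j) U_(i)%MM.
Proof.
move=> ltij K nz; suff : (K == U_(i)%MM) || (K == U_(j)%MM).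
  case/orP => /eqP-> //; rewrite !mdeg1; split=> // k _; rewrite !psum1.
  by case: (ltnP j k) => // ltjk; rewrite (ltn_trans ltij ltjk).
apply: contraNT nz; rewrite negb_or ![K == _]eq_sym => /andP[/negPf Ki /negPf Kj].
rewrite /hl_factor; case: ltngtP => _; rewrite mcoeffB ?mcoeffZ !mcoeffX Ki Kj;
  by rewrite ?mulr0 subr0.
Qed.

(** If [a i < a j] this coefficient is [t] instead; the leading coefficient of [hl_num] comes from
    the nonincreasing rearrangement, for which that case does not arise. *)
Lemma hl_factor_lead n (R : idomainType) m (t : R)
    (a : {ffun 'I_m -> 'I_n.+1}) (i j : 'I_m) :
  (i < j)%N -> (a j <= a i)%N -> (hl_factor t a i j)@_U_(i) = 1.
Proof.
move=> ltij leji; have neq : (j == i) = false.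
  by apply/negbTE; rewrite neq_ltn ltij orbT.
by rewrite /hl_factor; case: ltngtP leji => // _ _;
  rewrite mcoeffB ?mcoeffZ !mcoeffXU eqxx neq ?mulr0 subr0.
Qed.

Lemma sum_ord_gt m (k : 'I_m) : (\sum_(j < m | (k < j)%N) 1 = m - k.+1)%N.
Proof.
have : (\sum_(j < m | (j < k.+1)%N) 1 + \sum_(j < m | (k < j)%N) 1 = m)%N.
  rewrite -[RHS]card_ord -sum1_card [RHS](bigID (fun j : 'I_m => (j < k.+1)%N)).
  by congr (_ + _)%N; apply: eq_bigl => j; rewrite -leqNgt.
rewrite -(big_ord_widen m (fun=> 1%N)) // sum1_card card_ord.
by move=> /(congr1 (subn^~ k.+1)); rewrite addKn.
Qed.

Lemma sum_mnm_staircase m :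
  (\sum_(i < m) \sum_(j < m | (i < j)%N) U_(i))%MM = staircase m.
Proof.
apply/mnmP => k; rewrite mnm_sumE mnmE (bigD1 k) //=.
rewrite [X in (_ + X)%N]big1 ?addn0 => [|i neq].
  rewrite mnm_sumE; under eq_bigr => j _ do rewrite mnm1E eqxx.
  exact: sum_ord_gt.
by rewrite mnm_sumE big1 // => j _; rewrite mnm1E (negPf neq).
Qed.

(** Every rearrangement is dominated by [lam], so all terms obey one bound. At the leading exponent
    ['X_[expo a]] must contribute exactly [lam], which leaves the nonincreasing rearrangement
    alone. *)
Lemma hl_num_domlead n (R : idomainType) (t : R) (lam : intpart n) m :
  (size lam <= m)%N ->
  domlead (hl_num t lam m) (intpart_mnm m lam + staircase m)%MM /\
  (hl_num t lam m)@_(intpart_mnm m lam + staircase m) = 1.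
Proof.
move=> lem; pose Q (a : {ffun 'I_m -> 'I_n.+1}) :=
  \prod_(i < m) \prod_(j < m | (i < j)%N) hl_factor t a i j.
have HQ a : domlead (Q a) (staircase m) /\ (Q a)@_(staircase m) =
    \prod_(i < m) \prod_(j < m | (i < j)%N) (hl_factor t a i j)@_U_(i).
  have H i := domlead_prod (index_enum 'I_m) (fun j => @hl_factor_domlead n R m t a i j).
  rewrite -sum_mnm_staircase.
  have [D ->] := domlead_prod (index_enum 'I_m) (fun i (_ : true) => (H i).1).
  by split=> //; apply: eq_bigr => i _; rewrite (H i).2.
have HX a : a \in rearr m lam ->
    domlead ('X_[expo a] : {mpoly R[m]}) (intpart_mnm m lam).
  move=> aP K; rewrite mcoeffX; have [<- _|_] := eqVneq (expo a) K; last by rewrite eqxx.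
  split=> [|k lek].
    rewrite !mdegE; under eq_bigr do rewrite mnmE; rewrite (rearr_sum aP).
    by under eq_bigr do rewrite mnmE; rewrite intpart_sum.
  rewrite /psum; under eq_bigr do rewrite mnmE.
  under [leqRHS]eq_bigr do rewrite mnmE.
  by rewrite -(big_ord_widen m (fun i => nth 0%N lam i)) // rearr_psum.
split=> [|]; first by apply: domlead_sum => a /HX/domleadM/(_ (HQ a).1)[].
rewrite raddf_sum /= (bigD1 (intpart_vec m lam)) ?rearr_vec //= [X in _ + X]big1 ?addr0.
  have vP : intpart_vec m lam \in rearr m lam by rewrite rearr_vec.
  have [_ E] := domleadM (HX _ vP) (HQ (intpart_vec m lam)).1.
  apply: etrans E _.
  rewrite (HQ _).2 mcoeffX (_ : expo _ = intpart_mnm m lam) ?eqxx ?mul1r.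
    apply: big1 => i _; apply: big1 => j ltij; apply: hl_factor_lead => //.
    by rewrite !ffunE intpart_nth_leq // ltnW.
  by apply/mnmP => i; rewrite !mnmE ffunE.
move=> a /andP[aP neq]; have [_ E0] := domleadM (HX _ aP) (HQ a).1.
apply: etrans E0 _; rewrite mcoeffX; case: eqP => [E|]; last by rewrite mul0r.
case/eqP: neq; apply/ffunP => i; apply: val_inj; rewrite ffunE /=.
by move/mnmP/(_ i): E; rewrite !mnmE.
Qed.

(** * Alternating polynomials and the unitriangular expansion *)

Definition alternating (R : nzRingType) m (p : {mpoly R[m]}) : Prop :=
  forall (s : 'S_m) (K : 'X_{1..m}), p@_[multinom K (s i) | i < m] = (-1) ^+ s * p@_K.

Lemma alternatingB (R : nzRingType) m (p q : {mpoly R[m]}) :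
  alternating p -> alternating q -> alternating (p - q).
Proof. by move=> Hp Hq s K; rewrite !mcoeffB Hp Hq mulrBr. Qed.

Lemma alternating_sumZ (R : comNzRingType) m (I : Type) (r : seq I) (P : pred I)
    (c : I -> R) (F : I -> {mpoly R[m]}) :
  (forall i, P i -> alternating (F i)) ->
  alternating (\sum_(i <- r | P i) c i *: F i).
Proof.
move=> H s K; rewrite !raddf_sum /= mulr_sumr; apply: eq_bigr => i Pi.
by rewrite !mcoeffZ H // mulrCA.
Qed.

(** Renaming the variables by [s] permutes the rearrangements, and the product of the antisymmetric
    [hl_factor] supplies the sign. *)
Lemma hl_num_alternating n (R : comNzRingType) (t : R) (lam : intpart n) m :
  alternating (hl_num t lam m).
Proof.
move=> s K; rewrite -mcoeff_sym.
suff -> : msym s (hl_num t lam m) = (-1) ^+ s *: hl_num t lam m by rewrite mcoeffZ.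
pose h (a : {ffun 'I_m -> 'I_n.+1}) : {ffun 'I_m -> 'I_n.+1} := [ffun i => a (s i)].
have h_inj : injective h.
  move=> a b /ffunP E; apply/ffunP => i; have := E (s^-1 i)%g.
  by rewrite !ffunE permKV.
rewrite /hl_num raddf_sum /= (reindex_inj h_inj) /= scaler_sumr.
apply: eq_big => [a|a _]; first exact: rearr_perm.
rewrite msymM msymX; set X1 := 'X_[_]; have -> : X1 = 'X_[expo a].
  by congr 'X_[_]; apply/mnmP => i; rewrite !mnmE ffunE permKV.
rewrite scalerAr; congr (_ * _).
pose f i j := hl_factor t a i j.
have := prod_perm_alternating s (hl_factorN t a).
rewrite -[_ *: _]mul_mpolyC rmorphXn rmorphN1 => <-.
rewrite rmorph_prod; apply: eq_bigr => i _ /=.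
rewrite rmorph_prod; apply: eq_bigr => j _ /=.
rewrite /hl_factor !ffunE.
have XE k : msym s ('X_k : {mpoly R[m]}) = 'X_(s k).
  rewrite msymX; congr 'X_[_]; apply/mnmP => l; rewrite !mnmE.
  by rewrite -(inj_eq (@perm_inj _ s)) permKV.
by case: ltngtP => _; rewrite msymB ?msymZ !XE.
Qed.

(** Strictly decreasing exponents are entrywise at least the staircase, so the truncated subtraction
    in [f] loses nothing and leaves a nonincreasing sequence, whose positive entries form [mu]. *)
Lemma intpart_of_decreasing n m (K : 'X_{1..m}) :
  (forall i j : 'I_m, (i < j)%N -> (K j < K i)%N) ->
  mdeg K = (n + mdeg (staircase m))%N ->
  exists2 mu : intpart n, (size mu <= m)%N & K = (intpart_mnm m mu + staircase m)%MM.
Proof.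
move=> Kdec degK; pose f i := (nth 0%N K i - (m - i.+1))%N.
have Ki (i : 'I_m) : nth 0%N K i = K i by rewrite -mnm_nth.
have Kge (i : 'I_m) : (m - i.+1 <= K i)%N.
  have [d dE] : exists d, (m - i.+1 = d)%N by exists (m - i.+1)%N.
  rewrite dE; elim: d i dE => // d IHd i dE.
  have lti : (i.+1 < m)%N by lia.
  have := IHd (Ordinal lti); have /= := Kdec i (Ordinal lti) (ltnSn i).
  by move=> lt1 /(_ ltac:(lia)); lia.
have f_mono i j : (i <= j)%N -> (j < m)%N -> (f j <= f i)%N.
  move=> leij ltj; elim: j leij ltj => [|j IHj]; first by rewrite leqn0 => /eqP->.
  rewrite leq_eqVlt => /predU1P[-> //|leij ltj].
  apply: leq_trans (IHj leij (ltnW ltj)).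
  have := Kdec (Ordinal (ltnW ltj)) (Ordinal ltj) (ltnSn j).
  rewrite /f -(Ki (Ordinal ltj)) -(Ki (Ordinal (ltnW ltj))) /=.
  by have := Kge (Ordinal ltj); rewrite -Ki /=; lia.
pose mu := [seq k <- [seq f i | i <- iota 0 m] | (0 < k)%N].
have sort_f : sorted geq [seq f i | i <- iota 0 m].
  apply/(sortedP 0%N) => i; rewrite size_map size_iota => lti.
  rewrite !(nth_map 0%N) ?size_iota ?nth_iota //; try exact: ltnW.
  exact: f_mono.
have sum_f : sumn [seq f i | i <- iota 0 m] = n.
  rewrite sumnE big_map -[X in iota 0 X]subn0 -/(index_iota 0 m) big_mkord.
  apply: (@addIn (mdeg (staircase m))); rewrite -degK !mdegE -big_split /=.
  by apply: eq_bigr => i _; rewrite mnmE /f Ki subnK.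
have sum_filter s : sumn [seq k <- s | (0 < k)%N] = sumn s.
  by elim: s => //= -[|a] s IHs //=; rewrite IHs.
have muP : is_intpart n mu.
  apply/and3P; split; last by rewrite sum_filter sum_f.
    exact: (sorted_filter geq_trans).
  exact: filter_all.
exists (IntPart muP) => /=.
  by rewrite size_filter (leq_trans (count_size _ _)) // size_map size_iota.
have nth_filter s i : sorted geq s -> nth 0%N [seq k <- s | (0 < k)%N] i = nth 0%N s i.
  elim: s i => //= a s IHs i srt.
  have srt' := path_sorted srt.
  case: a srt => [|a] srt /=; last by case: i => //= i; apply: IHs.
  have s0 : all (pred1 0%N) s.
    apply/allP => x /(allP (order_path_min geq_trans srt)).
    by rewrite /= leqn0.
  rewrite (_ : filter _ s = [::]) ?nth_nil.
    case: i => //= i; have [lt|ge] := ltnP i (size s); last by rewrite nth_default.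
    by apply/esym/eqP; apply: (allP s0); apply: mem_nth.
  apply/eqP; rewrite -(negbK (_ == _)) -has_filter; apply/hasPn => x /(allP s0).
  by move/eqP->.
apply/mnmP => i; rewrite mnmDE !mnmE nth_filter //.
by rewrite (nth_map 0%N) ?size_iota // nth_iota // add0n /f Ki subnK.
Qed.

(** Sorting an exponent changes its coefficient only by a sign. If two entries of the sorted
    exponent agree, their transposition shows the coefficient to be its own opposite, hence zero;
    otherwise the exponent is some [mu + staircase]. *)
Lemma alternating_eq0 n (R : idomainType) m (p : {mpoly R[m]}) :
  (forall x : R, x = - x -> x = 0) -> alternating p ->
  (forall K, p@_K != 0 -> mdeg K = (n + mdeg (staircase m))%N) ->
  (forall mu : intpart n, (size mu <= m)%N ->
     p@_(intpart_mnm m mu + staircase m) = 0) ->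
  p = 0.
Proof.
move=> R2 altp degp p0; apply/mpolyP => K; rewrite mcoeff0; apply/eqP.
apply: contraT => pK; pose L := sort geq K.
have /tuple_permP[s sE] : perm_eq L K by rewrite perm_sort.
have {sE}LE (i : 'I_m) : nth 0%N L i = K (s i).
  by rewrite sE -(tnth_nth _ [tuple _ | _ < _] i) tnth_mktuple.
have szL : size L = m by rewrite size_sort size_tuple.
pose M : 'X_{1..m} := [multinom K (s i) | i < m].
have pM : p@_M != 0 by rewrite altp mulf_neq0 ?signr_eq0.
have Mdec (i j : 'I_m) : (i < j)%N -> (M j < M i)%N.
  move=> ltij; rewrite ltn_neqAle; apply/andP; split; last first.
    rewrite !mnmE -!LE.
    have srtL : sorted geq L by apply: sort_sorted => a b; apply: leq_total.
    have H := sorted_leq_nth geq_trans leqnn 0%N srtL.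
    by apply: (H i j); rewrite ?inE ?szL // ltnW.
  apply: contraNneq pM => Mij; apply/eqP/R2; rewrite -mulN1r.
  have neq : i != j by rewrite neq_ltn ltij.
  have := altp (tperm i j) M; rewrite odd_tperm neq expr1 => <-; congr _@__.
  by apply/mnmP => k; rewrite mnmE; case: tpermP => [->|->|].
have [mu lemu ME] := intpart_of_decreasing Mdec (degp _ pM).
by rewrite -(p0 mu lemu) -ME eqxx in pM.
Qed.

Lemma dominated_of_psum n m (mu lam : intpart n) :
  (size mu <= m)%N -> (size lam <= m)%N ->
  (forall k, (k <= m)%N ->
     (psum k (intpart_mnm m mu) <= psum k (intpart_mnm m lam))%N) ->
  dominated mu lam.
Proof.
move=> lemu lelam H; apply/dominatedP => k.
have [lekm|/ltnW ltmk] := leqP k m; last first.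
  by rewrite !intpart_sum // (leq_trans _ ltmk).
have psumE (nu : intpart n) : psum k (intpart_mnm m nu) = (\sum_(i < k) nth 0%N nu i)%N.
  by rewrite /psum (big_ord_widen m) //; apply: eq_bigr => i _; rewrite mnmE.
by have := H k lekm; rewrite !psumE.
Qed.

Lemma hl_num_coef_dominated n (R : idomainType) (t : R) (mu lam : intpart n) m :
  (size mu <= m)%N -> (size lam <= m)%N ->
  (hl_num t lam m)@_(intpart_mnm m mu + staircase m) != 0 -> dominated mu lam.
Proof.
move=> lemu lelam nz; apply: (dominated_of_psum lemu lelam) => k lekm.
have [_ /(_ k lekm)] := (hl_num_domlead t lelam).1 _ nz.
by rewrite !psumD leq_add2r.
Qed.

Lemma hl_num_degree n (R : idomainType) (t : R) (lam : intpart n) m K :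
  (size lam <= m)%N -> (hl_num t lam m)@_K != 0 ->
  mdeg K = (n + mdeg (staircase m))%N.
Proof.
move=> lem nz; have [-> _] := (hl_num_domlead t lem).1 _ nz.
rewrite mdegD; congr (_ + _)%N; rewrite mdegE.
by under eq_bigr do rewrite mnmE; rewrite intpart_sum.
Qed.

(** With [n <= m] every partition of [n] fits into [m] variables. With fewer variables the diagonal
    entries of the system would vanish at the partitions with more than [m] parts. *)
Lemma hl_num_expansion_large n (R : idomainType) (t : R) (lam : intpart n) m :
  (forall x : R, x = - x -> x = 0) -> (n <= m)%N ->
  exists c : intpart n -> R, [/\ forall mu, ~~ dominated mu lam -> c mu = 0,
    c lam = 1
    & hl_num t lam m = vdm R m *
        \sum_(mu | dominated mu lam) c mu *: monom_poly R mu m].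
Proof.
move=> R2 lenm; have sz (mu : intpart n) := leq_trans (intpart_size mu) lenm.
pose ex (mu : intpart n) := (intpart_mnm m mu + staircase m)%MM.
have [mu|||c [c0 c1 cE]] := @unitriangular_solve _ R (@dominated n)
    (fun nu mu => (hl_num 1 nu m)@_(ex mu)) (@dominated_refl n) (@dominated_anti n)
    (@dominated_trans n) _ _ lam (fun mu => (hl_num t lam m)@_(ex mu)).
- by move=> nu; apply: hl_num_coef_dominated.
- by move=> mu; have [_] := hl_num_domlead (1 : R) (sz mu).
- by move=> mu; apply: hl_num_coef_dominated.
exists c; split=> //; first by rewrite c1; have [_] := hl_num_domlead t (sz lam).
rewrite mulr_sumr; under eq_bigr => mu _ do rewrite -scalerAr -hl_num1.
apply/eqP; rewrite -subr_eq0; apply/eqP; apply: (@alternating_eq0 n) => //.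
- apply: alternatingB; first exact: hl_num_alternating.
  by apply: alternating_sumZ => mu _; apply: hl_num_alternating.
- move=> K; rewrite mcoeffB => nz.
  have [tK|/(hl_num_degree (sz lam))//] := eqVneq (hl_num t lam m)@_K 0.
  rewrite tK sub0r oppr_eq0 raddf_sum /= in nz.
  case: (pickP [pred mu | dominated mu lam && ((c mu *: hl_num 1 mu m)@_K != 0)]).
    move=> mu /andP[_]; rewrite mcoeffZ mulf_eq0 negb_or => /andP[_].
    exact: hl_num_degree.
  move=> H; rewrite big1 ?eqxx // in nz => mu dmu.
  by have := H mu; rewrite /= dmu /= => /negbFE/eqP.
- move=> mu _; rewrite mcoeffB [X in _ - X]raddf_sum /=; apply/eqP; rewrite subr_eq0.
  by apply/eqP; apply: (etrans (cE mu)); apply: eq_bigr => nu _; rewrite mcoeffZ.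
Qed.

Lemma monom_poly_coef n (R : comNzRingType) (mu nu : intpart n) m :
  (size nu <= m)%N -> (monom_poly R mu m)@_(intpart_mnm m nu) = (nu == mu)%:R.
Proof.
move=> lem; rewrite raddf_sum /=.
have E a : (('X_[expo a] : {mpoly R[m]})@_(intpart_mnm m nu)) =
    (a == intpart_vec m nu)%:R.
  rewrite mcoeffX; congr (_%:R); congr nat_of_bool; apply/eqP/eqP => [E|->].
    apply/ffunP => i; apply: val_inj; rewrite ffunE /=.
    by move/mnmP/(_ i): E; rewrite !mnmE.
  by apply/mnmP => i; rewrite !mnmE ffunE.
rewrite -(rearr_vec mu lem) big_mkcond (bigD1 (intpart_vec m nu)) //= big1.
  by rewrite addr0 E eqxx; case: ifP.
by move=> a neq; case: ifP => // _; rewrite E (negPf neq).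
Qed.

Lemma monom_poly_sum_coef n (R : comNzRingType) (P : pred (intpart n))
    (c : intpart n -> R) m (nu : intpart n) :
  (size nu <= m)%N ->
  (\sum_(mu | P mu) c mu *: monom_poly R mu m)@_(intpart_mnm m nu) =
  if P nu then c nu else 0.
Proof.
move=> lem; rewrite raddf_sum /= big_mkcond (bigD1 nu) //= [X in _ + X]big1.
  by rewrite addr0 mcoeffZ monom_poly_coef // eqxx mulr1.
move=> mu neq; case: ifP => // _.
by rewrite mcoeffZ monom_poly_coef // eq_sym (negPf neq) mulr0.
Qed.

Lemma prod_ltn_recr (R : comPzRingType) m (f : 'I_m.+1 -> 'I_m.+1 -> R) :
  let w := widen_ord (leqnSn m) in
  \prod_(i < m.+1) \prod_(j < m.+1 | (i < j)%N) f i j =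
  (\prod_(i < m) f (w i) ord_max) *
  \prod_(i < m) \prod_(j < m | (i < j)%N) f (w i) (w j).
Proof.
move=> w; rewrite big_ord_recr /= [X in _ * X]big_pred0 ?mulr1; last first.
  by move=> j; rewrite ltnNge -ltnS ltn_ord.
rewrite -big_split /=; apply: eq_bigr => i _.
rewrite big_mkcond big_ord_recr /= ltn_ord mulrC; congr (_ * _).
by rewrite [RHS]big_mkcond.
Qed.

(** * Setting the last variable to zero *)

Section Restriction.

Variables (n m : nat) (R : idomainType).

Let w := widen_ord (leqnSn m).

Let restr : m.+1.-tuple {mpoly R[m]} :=
  [tuple if unlift ord_max i is Some j then 'X_j else 0 | i < m.+1].

Lemma unlift_max_widen i : unlift ord_max (w i) = Some i.
Proof.
have -> : w i = lift ord_max i by apply: val_inj; rewrite /= /bump leqNgt ltn_ord.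
exact: liftK.
Qed.

Lemma restrX_widen i : 'X_(w i) \mPo restr = 'X_i.
Proof. by rewrite comp_mpolyXU -tnth_nth tnth_mktuple unlift_max_widen. Qed.

Lemma restrX_max : 'X_ord_max \mPo restr = 0.
Proof. by rewrite comp_mpolyXU -tnth_nth tnth_mktuple unlift_none. Qed.

Let ext (b : {ffun 'I_m -> 'I_n.+1}) : {ffun 'I_m.+1 -> 'I_n.+1} :=
  [ffun i => if unlift ord_max i is Some j then b j else ord0].

Lemma ext_widen b i : ext b (w i) = b i.
Proof. by rewrite ffunE unlift_max_widen. Qed.

Lemma ext_max b : ext b ord_max = ord0.
Proof. by rewrite ffunE unlift_none. Qed.

Lemma rearr_ext lam b : (ext b \in rearr m.+1 lam) = (b \in rearr m lam).
Proof.
rewrite !inE enum_ordSr map_rcons ext_max filter_rcons /= -map_comp.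
by under eq_map do rewrite /= ext_widen.
Qed.

Lemma restr_expo b : 'X_[expo (ext b)] \mPo restr = 'X_[expo b].
Proof.
rewrite mpolyXE_id rmorph_prod big_ord_recr /= mnmE ext_max expr0 rmorph1 mulr1.
rewrite mpolyXE_id; apply: eq_bigr => i _.
by rewrite rmorphXn /= restrX_widen !mnmE ext_widen.
Qed.

(** Terms with a nonzero last entry vanish; the remaining rearrangements are exactly those in [m]
    variables, extended by 0. *)
Lemma restr_rearr_sum lam (F : {ffun 'I_m.+1 -> 'I_n.+1} -> {mpoly R[m.+1]}) :
  (\sum_(a in rearr m.+1 lam) 'X_[expo a] * F a) \mPo restr =
  \sum_(b in rearr m lam) 'X_[expo b] * (F (ext b) \mPo restr).
Proof.
rewrite rmorph_sum /= (bigID (fun a : {ffun _} => a ord_max == ord0)) /=.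
rewrite [X in _ + X]big1 ?addr0 => [|a /andP[_ nz]]; last first.
  rewrite rmorphM /= mpolyXE_id rmorph_prod big_ord_recr /= rmorphXn /=.
  have nz' : ((a ord_max : nat) == 0%N) = false := negPf nz.
  by rewrite restrX_max mnmE expr0n nz' mulr0 mul0r.
rewrite (reindex_onto ext (fun a => [ffun i => a (w i)])) /=; last first.
  move=> a /andP[_ /eqP a0]; apply/ffunP => i; rewrite ffunE.
  by case: unliftP => [j ->|->]; rewrite ?ffunE ?a0 //; congr (a _);
    apply: val_inj; rewrite /= /bump leqNgt ltn_ord.
apply: eq_big => [b|b _]; last by rewrite rmorphM /= restr_expo.
rewrite rearr_ext ext_max eqxx andbT andb_idr // => _; apply/eqP/ffunP => i.
by rewrite ffunE ext_widen.
Qed.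

Lemma restr_vdm : vdm R m.+1 \mPo restr = (\prod_(i < m) 'X_i) * vdm R m.
Proof.
rewrite /vdm prod_ltn_recr rmorphM /= !rmorph_prod; congr (_ * _).
  by apply: eq_bigr => i _; rewrite rmorphB /= restrX_widen restrX_max subr0.
apply: eq_bigr => i _; rewrite rmorph_prod; apply: eq_bigr => j _.
by rewrite rmorphB /= !restrX_widen.
Qed.

Lemma restr_monom_poly (lam : intpart n) :
  monom_poly R lam m.+1 \mPo restr = monom_poly R lam m.
Proof.
have := restr_rearr_sum lam (fun _ => 1).
under eq_bigr do rewrite mulr1; move=> ->; apply: eq_bigr => a _.
by rewrite rmorph1 mulr1.
Qed.

(** An extended rearrangement ends in 0, so the pair formed by [i] and the last place contributes
    ['X_i], whether the entry at [i] is positive or zero. This is the same extra factor as in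
    [restr_vdm], hence it cancels. *)
Lemma restr_hl_num t (lam : intpart n) :
  hl_num t lam m.+1 \mPo restr = (\prod_(i < m) 'X_i) * hl_num t lam m.
Proof.
rewrite /hl_num restr_rearr_sum mulr_sumr; apply: eq_bigr => b _.
rewrite mulrCA; congr (_ * _); rewrite prod_ltn_recr rmorphM /= !rmorph_prod.
congr (_ * _).
  apply: eq_bigr => i _; rewrite /hl_factor ext_max ltn0; case: ifP => _;
    by rewrite rmorphB /= ?comp_mpolyZ restrX_widen restrX_max ?scaler0 subr0.
apply: eq_bigr => i _; rewrite rmorph_prod; apply: eq_bigr => j _.
rewrite /hl_factor !ext_widen; case: ltngtP => _;
  by rewrite rmorphB /= ?comp_mpolyZ !restrX_widen.
Qed.

Lemma hl_num_expansion_restrict t (lam : intpart n) (P : pred (intpart n)) c :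
  hl_num t lam m.+1 = vdm R m.+1 * \sum_(mu | P mu) c mu *: monom_poly R mu m.+1 ->
  hl_num t lam m = vdm R m * \sum_(mu | P mu) c mu *: monom_poly R mu m.
Proof.
move/(congr1 (comp_mpoly restr)); rewrite rmorphM /= restr_vdm restr_hl_num.
rewrite -mulrA raddf_sum /= => /mulfI E; rewrite E.
  congr (_ * _); apply: eq_bigr => mu _.
  by rewrite comp_mpolyZ restr_monom_poly.
apply/prodf_neq0 => i _; apply/eqP => /(congr1 (mcoeff U_(i)%MM)) /eqP.
by rewrite mcoeffXU eqxx mcoeff0 oner_eq0.
Qed.

End Restriction.

(** The coefficients are those for [m = n]. Restriction gives the smaller [m]; for larger [m], an
    expansion restricted to [n] variables must agree with the chosen one, since the monomial
    functions are independent there. *)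
Lemma hl_num_expansion n (R : idomainType) (t : R) (lam : intpart n) :
  (forall x : R, x = - x -> x = 0) ->
  exists c : intpart n -> R, [/\ forall mu, ~~ dominated mu lam -> c mu = 0,
    c lam = 1
    & forall m, hl_num t lam m = vdm R m *
        \sum_(mu | dominated mu lam) c mu *: monom_poly R mu m].
Proof.
move=> R2; pose E (c : intpart n -> R) m := hl_num t lam m = vdm R m *
  \sum_(mu | dominated mu lam) c mu *: monom_poly R mu m.
have down c m d : E c (m + d)%N -> E c m.
  elim: d => [|d IHd]; first by rewrite addn0.
  by rewrite addnS => /hl_num_expansion_restrict.
have [c [c0 c1 cE]] := hl_num_expansion_large t lam R2 (leqnn n).
exists c; split=> // m; have [lemn|/ltnW lenm] := leqP m n.
  by apply: (down _ _ (n - m)%N); rewrite subnKC.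
have [d [d0 _ dE]] := hl_num_expansion_large t lam R2 lenm.
have En : E d n by apply: (down _ _ (m - n)%N); rewrite subnKC.
have S : \sum_(mu | dominated mu lam) d mu *: monom_poly R mu n =
    \sum_(mu | dominated mu lam) c mu *: monom_poly R mu n.
  by apply: (mulfI (vdm_neq0 R n)); apply: etrans (esym En) cE.
rewrite /E dE; congr (_ * _); apply: eq_bigr => mu domu; congr (_ *: _).
have := congr1 (mcoeff (intpart_mnm n mu)) S.
by rewrite !monom_poly_sum_coef ?intpart_size // domu.
Qed.

(** * Specialization at t = 0 *)

Lemma coef_prod_top (R : comNzRingType) (I : Type) (r : seq I) (P : pred I)
    (F : I -> {poly R}) (d : I -> nat) :
  (forall i, P i -> (size (F i) <= (d i).+1)%N) ->
  (size (\prod_(i <- r | P i) F i)%R <= (\sum_(i <- r | P i) d i).+1)%N /\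
  (\prod_(i <- r | P i) F i)`_(\sum_(i <- r | P i) d i)%N =
    \prod_(i <- r | P i) (F i)`_(d i).
Proof.
move=> sF; elim: r => [|i r [szr cfr]]; first by rewrite !big_nil coef1 size_poly1.
rewrite !big_cons; case: ifP => // /sF szi; split.
  apply: leq_trans (size_polyMleq _ _) _; lia.
set q := \prod_(_ <- _ | _) _ in szr cfr *.
set e := (\sum_(_ <- _ | _) _)%N in szr cfr *.
have lt : (d i < (d i + e).+1)%N by rewrite ltnS leq_addr.
rewrite coefM (bigD1 (Ordinal lt)) //= big1 ?addr0; first by rewrite addKn cfr.
move=> j neq; have [ltj|] := ltnP j (d i).
  rewrite [q`__]nth_default ?mulr0 // (leq_trans szr) //; lia.
rewrite leq_eqVlt => /predU1P[E|ltj].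
  by case/eqP: neq; apply: val_inj.
by rewrite [(F i)`__]nth_default ?mul0r // (leq_trans szi).
Qed.

Lemma sum_maxn_perm m (a : 'I_m -> nat) (s : 'S_m) :
  (\sum_(i < m) \sum_(j < m | (s i < s j)%N) maxn (a i) (a j) =
   \sum_(i < m) \sum_(j < m | (i < j)%N) maxn (a i) (a j))%N.
Proof.
under eq_bigr do rewrite big_mkcond.
rewrite big_ltn_pairs => [|i]; last by rewrite ltnn.
apply: eq_bigr => i _; apply: eq_bigr => j ltij.
case: ltngtP => [_|_|/val_inj/perm_inj E].
- exact: addn0.
- exact: maxnC.
- by rewrite E ltnn in ltij.
Qed.

(* Both sides are the leading coefficient in y of the Vandermonde determinant
   of the variables x_i y^(a_i); only the permutations sorting a reach the
   leading degree. *)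
Lemma vandermonde_lead (R : comNzRingType) m (x : 'I_m -> R) (a : 'I_m -> nat) :
  \prod_(i < m) \prod_(j < m | (i < j)%N)
     (if (a j < a i)%N then x i else if (a i < a j)%N then - x j else x i - x j) =
  \sum_(s : 'S_m | [forall i, [forall (j | (s i < s j)%N), (a j <= a i)%N]])
     (-1) ^+ s * \prod_(i < m) x i ^+ (m - (s i).+1).
Proof.
pose y i : {poly R} := (x i)%:P * 'X^(a i).
pose N := (\sum_(i < m) \sum_(j < m | (i < j)%N) maxn (a i) (a j))%N.
transitivity ((\prod_(i < m) \prod_(j < m | (i < j)%N) (y i - y j))`_N).
  have H (i j : 'I_m) : (size (y i - y j)%R <= (maxn (a i) (a j)).+1)%N.
    have sy k : (size (y k) <= (a k).+1)%N.
      rewrite (leq_trans (size_polyMleq _ _)) // size_polyXn size_polyC.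
      by case: (_ != 0).
    rewrite (leq_trans (size_polyD _ _)) // size_polyN geq_max.
    by rewrite !(leq_trans (sy _)) // ltnS ?leq_maxl ?leq_maxr.
  have H' (i : 'I_m) := coef_prod_top (index_enum 'I_m) (fun j (_ : (i < j)%N) => H i j).
  have [_ ->] := coef_prod_top (index_enum 'I_m) (fun i (_ : true) => (H' i).1).
  apply: eq_bigr => i _; rewrite (H' i).2; apply: eq_bigr => j _.
  rewrite coefB !coefCM !coefXn; case: ltngtP => [lt|lt|->].
  - by rewrite eqxx (gtn_eqF lt) mulr0 mulr1 subr0.
  - by rewrite eqxx (gtn_eqF lt) mulr0 mulr1 sub0r.
  - by rewrite !eqxx !mulr1.
rewrite -det_Vandermonde_rev coef_sum [RHS]big_mkcond; apply: eq_bigr => s _.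
under eq_bigr do rewrite mxE exprMn -polyC_exp -exprM.
rewrite big_split /= -rmorph_prod prodrXr /=.
have -> : (-1) ^+ s = ((-1) ^+ s)%:P :> {poly R} by rewrite polyC_exp polyCN.
rewrite !coefCM coefXn.
(* The degree in y of the term of [s]: the exponent [m - (s i).+1] counts the [j] with
   [s i < s j]. *)
have E : (\sum_(i < m) a i * (m - (s i).+1) =
    \sum_(i < m) \sum_(j < m | (s i < s j)%N) a i)%N.
  apply: eq_bigr => i _; rewrite -sum_ord_gt (reindex_inj (@perm_inj _ s)) /=.
  by rewrite big_distrr /=; apply: eq_bigr => j _; rewrite muln1.
(* Each pair falls short of its maximum unless [a j <= a i], so degree [N] is reached exactly by the
   permutations that sort [a]. *)
have := leqif_sum (fun i (_ : true) => leqif_sum (fun j (_ : (s i < s j)%N) =>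
  (conj (leq_maxl (a i) (a j))
     (sameP eqP (iffP maxn_idPl esym esym) : _ = (a j <= a i)%N)
   : (a i <= maxn (a i) (a j) ?= iff (a j <= a i))%N))).
rewrite -E sum_maxn_perm -/N => -[_]; rewrite eq_sym => ->.
by case: ifP => _; rewrite ?mulr1 ?mulr0.
Qed.

Lemma rearr_nonincreasing n m (lam : intpart n) (a : {ffun 'I_m -> 'I_n.+1}) :
  a \in rearr m lam -> (forall i j : 'I_m, (i < j)%N -> (a j <= a i)%N) ->
  a = intpart_vec m lam.
Proof.
move=> aP adec; have /rearrP[lem [s sE]] := aP.
have srt (f : 'I_m -> nat) : (forall i j : 'I_m, (i < j)%N -> (f j <= f i)%N) ->
    sorted geq [tuple f i | i < m].
  move=> fdec; have szf : size [tuple f i | i < m] = m by rewrite size_tuple.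
  apply/(sortedP 0%N) => i; rewrite szf => lti.
  have := fdec (Ordinal (ltnW lti)) (Ordinal lti) (ltnSn i).
  by rewrite -(tnth_mktuple f (Ordinal lti)) -(tnth_mktuple f (Ordinal (ltnW lti)))
    !(tnth_nth 0%N).
pose f (i : 'I_m) := nth 0%N lam i.
have E : [tuple (a i : nat) | i < m] = [tuple f i | i < m] :> seq nat.
  apply: (sorted_eq geq_trans geq_anti); first exact: srt.
    by apply: srt => i j /ltnW; apply: intpart_nth_leq.
  apply/tuple_permP; exists s; congr tval; apply: eq_from_tnth => i.
  by rewrite !tnth_mktuple sE.
apply/ffunP => i; apply: val_inj; rewrite ffunE /=.
by have /(congr1 (fun t => tnth t i)) := val_inj E; rewrite !tnth_mktuple.
Qed.

(** [vandermonde_lead] expands the product attached to [a] over the permutations that sort [a].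
    Conversely each [s] sorts exactly one rearrangement, [lam] composed with [s], so exchanging the
    sums leaves the Leibniz formula of the determinant. *)
Lemma hl_num0 n (R : comNzRingType) (lam : intpart n) m : (size lam <= m)%N ->
  hl_num 0 lam m =
  \det (\matrix_(i < m, j < m) ('X_i ^+ (nth 0%N lam j + (m - j.+1)) : {mpoly R[m]})).
Proof.
move=> lem; pose C (a : {ffun 'I_m -> 'I_n.+1}) (s : 'S_m) :=
  [forall i, [forall (j | (s i < s j)%N), (a j <= a i)%N]].
pose vec (s : 'S_m) : {ffun 'I_m -> 'I_n.+1} := [ffun i => intpart_vec m lam (s i)].
have CE a s : (a \in rearr m lam) && C a s = (a == vec s).
  apply/andP/eqP => [[aP /forallP Cas]|->].
    have -> : [ffun i => a (s^-1 i)%g] = intpart_vec m lam :> {ffun _} -> a = vec s.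
      move=> /ffunP E; apply/ffunP => i; have := E (s i).
      by rewrite !ffunE permK.
      by [].
    apply: rearr_nonincreasing; first by rewrite rearr_perm.
    move=> i j ltij; rewrite !ffunE.
    by have /forall_inP := Cas (s^-1 i)%g; apply; rewrite !permKV.
  rewrite rearr_perm rearr_vec // eqxx; split=> //; apply/forallP => i.
  apply/forall_inP => j /ltnW ltij; rewrite !ffunE /=.
  exact: intpart_nth_leq.
transitivity (\sum_(a in rearr m lam) \sum_(s : 'S_m | C a s)
   (-1) ^+ s * ('X_[expo a] * \prod_(i < m) 'X_i ^+ (m - (s i).+1) : {mpoly R[m]})).
  apply: eq_bigr => a _; under [RHS]eq_bigr do rewrite mulrCA.
  rewrite -mulr_sumr -vandermonde_lead; congr (_ * _).
  apply: eq_bigr => i _; apply: eq_bigr => j _.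
  by rewrite /hl_factor !scale0r subr0 sub0r.
rewrite (exchange_big_dep predT) //=; apply: eq_bigr => s _.
rewrite (big_pred1 (vec s)) => [|a]; last exact: CE.
congr (_ * _); rewrite mpolyXE_id -big_split; apply: eq_bigr => i _ /=.
by rewrite mxE !mnmE !ffunE /= exprD.
Qed.

(** In fewer than [size lam] variables the convention in [schur] gives 0, and the sum over
    rearrangements is empty. *)
Lemma schurE n (R : idomainType) (lam : intpart n) m :
  schur R lam m = hall_littlewood (0 : R) lam m.
Proof.
rewrite hall_littlewoodE /schur det_Vandermonde_rev; case: leqP => [le|lt].
  by rewrite hl_num0.
rewrite /hl_num big1 ?rmorph0 ?mul0r // => a /rearr_size.
by rewrite leqNgt lt.
Qed.

(** * Partial fractions for the complete homogeneous functions *)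

Section PartialFractions.

Variables (F : fieldType) (I : eqType) (x : I -> F).
Hypothesis x_inj : injective x.

(** For a repetition-free nonempty [r] of length p this is the complete homogeneous function of
    degree k - p + 1 in the [x i] with [i] in [r]. *)
Let G k (r : seq I) :=
  \sum_(i <- r) x i ^+ k / \prod_(j <- r | j != i) (x i - x j).

(** The term of [i] cancels, and in the term of [j] the difference [x j - x i] removes one factor of
    the denominator. It mirrors the recurrence of the complete homogeneous functions on adding a
    variable. *)
Let G_cons k i r : i \notin r ->
  G k.+1 (i :: r) - x i * G k (i :: r) = G k r.
Proof.
move=> nir; rewrite /G mulr_sumr -sumrB big_cons exprS mulrA subrr add0r.
apply: eq_big_seq => j jr; have neq : i != j by apply: contraNneq nir => ->.
rewrite big_cons neq exprS -mulrA -mulrBl mulrC -mulrA; congr (_ * _).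
by rewrite invfM mulrAC mulVf ?mul1r // subr_eq0 (inj_eq x_inj) eq_sym.
Qed.

Let G_perm k r1 r2 : perm_eq r1 r2 -> G k r1 = G k r2.
Proof.
move=> pr; rewrite /G (perm_big _ pr); apply: eq_bigr => i _.
by rewrite (perm_big _ pr).
Qed.

(** Removing [i] and removing [j] by [G_cons] and subtracting writes [(x j - x i) * G 0] as a
    difference of two shorter sums: both are 1 on singletons, and both are 0 by induction
    otherwise. *)
Let G0 r : uniq r -> (1 < size r)%N -> G 0 r = 0.
Proof.
elim: {r}(size r) {-2}r (erefl (size r)) => [|p IHp] // [|i [|j r]] // [szr].
move=> /and3P[]; rewrite inE negb_or => /andP[neq nir] njr ur _.
have nz : x j - x i != 0 by rewrite subr_eq0 (inj_eq x_inj) eq_sym.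
apply: (mulfI nz); rewrite mulr0.
have E1 : G 1 [:: i, j & r] - x i * G 0 [:: i, j & r] = G 0 (j :: r).
  by apply: G_cons; rewrite inE negb_or neq.
have E2 : G 1 [:: i, j & r] - x j * G 0 [:: i, j & r] = G 0 (i :: r).
  have pr : perm_eq [:: i, j & r] [:: j, i & r].
    by rewrite -[[:: i, j & r]]/([:: i] ++ [:: j] ++ r) perm_catCA.
  by rewrite !(G_perm _ pr) G_cons // inE negb_or eq_sym neq.
rewrite mulrBl; transitivity (G 0 (j :: r) - G 0 (i :: r)).
  by rewrite -E1 -E2 opprB [RHS]addrC addrA subrK.
case: r szr nir njr ur {E1 E2} => [|l r] szr nir njr ur.
  by rewrite /G !big_seq1 !big_cons !big_nil !eqxx !expr0 subrr.
by rewrite !IHp ?subrr //= ?nir ?njr ?ur // -szr.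
Qed.

Variable n : nat.

Let Q (r : seq I) : {poly F} := \prod_(i <- r) \sum_(j < n.+1) (x i *: 'X) ^+ j.

(** The geometric series stop at degree [n] so that the expanded product runs over exponent vectors
    with entries in ['I_n.+1]. The error of the truncation, after the shift by ['X^((size r).-1)],
    lies beyond the range allowed for [k]. *)
Lemma partial_fraction_complete r : uniq r -> r != [::] ->
  forall k, (k <= n + (size r).-1)%N ->
  \sum_(i <- r) x i ^+ k / \prod_(j <- r | j != i) (x i - x j) =
  ('X^((size r).-1) * \prod_(i <- r) \sum_(j < n.+1) (x i *: 'X) ^+ j)`_k.
Proof.
have Qcons i s : (1 - x i *: 'X) * Q (i :: s) = (1 - (x i *: 'X) ^+ n.+1) * Q s.
  by rewrite /Q big_cons mulrA -[1 - _ ^+ _]opprB subrX1 -mulNr opprB.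
elim: r => // i [|i' r] IHr /andP[nir ur] _.
  move=> k; rewrite /= addn0 expr0 mul1r => lekn.
  rewrite /G /Q !big_seq1 big_cons eqxx big_nil divr1 coef_sum.
  rewrite (bigD1 (Ordinal (lekn : (k < n.+1)%N))) //= big1 ?addr0.
    by rewrite exprZn coefZ coefXn eqxx mulr1.
  move=> j neq; rewrite exprZn coefZ coefXn; case: eqP => [E|]; last by rewrite mulr0.
  by case/eqP: neq; apply: val_inj.
set s := i' :: r in nir ur IHr *; have szs : size s = (size r).+1 by [].
suff main k : (k <= n + size s)%N ->
    G k (i :: s) = ('X^(size s) * Q (i :: s))`_k by exact: main.
elim: k => [|k IHk] lek; first by rewrite coefXnM G0 //= nir ur.
rewrite -[LHS](subrK (x i * G k (i :: s))) G_cons // IHk; last exact: ltnW.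
have /= IHs := IHr ur isT k; rewrite [G k s]IHs; last by move: lek; rewrite szs; lia.
(* The coefficient of degree [k.+1] in [Qcons] is the counterpart of [G_cons]; the term in ['X^n.+1]
   does not reach this degree. *)
have E := congr1 (fun p => ('X^(size s) * p)`_k.+1) (Qcons i s).
move: E; rewrite /= !mulrBl !mul1r !mulrBr !coefB -!scalerAl -!scalerAr !coefZ.
rewrite exprZn -scalerAl -!scalerAr coefZ.
rewrite ['X^_ * ('X * _)]mulrCA coefXM /= ['X^_ * ('X^_ * _)]mulrA -exprD.
rewrite [('X^(_ + _) * _)`__]coefXnM ifT; last by move: lek => /=; lia.
rewrite mulr0 subr0 => /eqP; rewrite subr_eq => /eqP->; congr (_ + _).
by rewrite exprS -mulrA coefXM.
Qed.

End PartialFractions.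

(** * Transition coefficients *)

Lemma coordsP n (R : idomainType) (S : pred (intpart n))
    (b : intpart n -> forall m, ratfun R m) (f : forall m, ratfun R m) :
  (exists c, is_expansion S b f c) -> is_expansion S b f (coords S b f).
Proof. exact: epsilon_spec. Qed.

Lemma poly_int_eqN (x : {poly int}) : x = - x -> x = 0.
Proof.
move=> E; apply/polyP => i; rewrite coef0.
have := congr1 (fun p : {poly int} => p`_i) E; rewrite coefN => /eqP.
by rewrite -addr_eq0 -mulr2n Num.Theory.mulrn_eq0 => /eqP.
Qed.

(* [hl_coef] is unspecified outside [dominated mu lam]. *)
Definition hl_coef0 n (lam mu : intpart n) : {poly int} :=
  if dominated mu lam then hl_coef lam mu else 0.

Lemma hl_num_coords n (R : idomainType) (t : R) (lam : intpart n) m :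
  (forall x : R, x = - x -> x = 0) ->
  hl_num t lam m = vdm R m * \sum_(mu | dominated mu lam)
    coords (fun nu => dominated nu lam) (@monom n R) (hall_littlewood t lam) mu
      *: monom_poly R mu m.
Proof.
move=> /(hl_num_expansion t lam)[c [_ _ cE]].
have fracE m' (d : intpart n -> R) :
    \sum_(mu | dominated mu lam) tofrac (mpolyC m' (d mu)) * monom R mu m' =
    tofrac (\sum_(mu | dominated mu lam) d mu *: monom_poly R mu m').
  rewrite rmorph_sum; apply: eq_bigr => mu _ /=.
  by rewrite monomE -mul_mpolyC rmorphM.
have vnz m' : tofrac (vdm R m') != 0 by rewrite tofrac_eq0 vdm_neq0.
have /coordsP/(_ m) : exists c, is_expansion (fun nu => dominated nu lam)
    (@monom n R) (hall_littlewood t lam) c.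
  exists c => m'; rewrite fracE hall_littlewoodE cE rmorphM /=.
  by rewrite mulrAC mulfV ?mul1r //; apply: vnz.
rewrite fracE hall_littlewoodE => /(canRL (mulfVK (vnz m))).
by rewrite -rmorphM /= mulrC => /eqP; rewrite tofrac_eq => /eqP->.
Qed.

Lemma hl_num_hl_coef n (lam : intpart n) m :
  hl_num ('X : {poly int}) lam m =
  vdm _ m * \sum_mu hl_coef0 lam mu *: monom_poly _ mu m.
Proof.
rewrite (hl_num_coords 'X lam m poly_int_eqN).
rewrite [X in _ = _ * X](bigID (fun mu => dominated mu lam)) /=.
rewrite [X in _ * (_ + X)]big1 ?addr0 => [|mu /negPf nd]; last first.
  by rewrite /hl_coef0 nd scale0r.
by congr (_ * _); apply: eq_bigr => mu dmu; rewrite /hl_coef0 dmu.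
Qed.

Lemma monom_poly_sum_inj n (R : comNzRingType) (c d : intpart n -> R) :
  \sum_mu c mu *: monom_poly R mu n = \sum_mu d mu *: monom_poly R mu n -> c =1 d.
Proof.
move=> E mu; have := congr1 (mcoeff (intpart_mnm n mu)) E.
by rewrite !monom_poly_sum_coef ?intpart_size.
Qed.

Lemma hl_coef0_diag n (lam : intpart n) : hl_coef0 lam lam = 1.
Proof.
have [c [c0 <- cE]] := hl_num_expansion 'X lam poly_int_eqN.
suff /monom_poly_sum_inj-> : \sum_mu hl_coef0 lam mu *: monom_poly _ mu n =
  \sum_mu c mu *: monom_poly _ mu n by [].
apply: (mulfI (vdm_neq0 _ n)); rewrite -hl_num_hl_coef cE; congr (_ * _).
rewrite big_mkcond; apply: eq_bigr => mu _.
by case: ifPn => // /c0->; rewrite scale0r.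
Qed.

(** The generic coefficients serve every value [f 'X] of the parameter, because [hl_num] commutes
    with ring morphisms. *)
Lemma hall_littlewood_monom n (S : idomainType) (f : {rmorphism {poly int} -> S})
    (lam : intpart n) m :
  hall_littlewood (f 'X) lam m =
  tofrac (\sum_mu f (hl_coef0 lam mu) *: monom_poly S mu m).
Proof.
rewrite hall_littlewoodE -map_hl_num hl_num_hl_coef rmorphM /= map_vdm.
rewrite [tofrac (_ * _)]rmorphM /= mulrAC mulfV ?mul1r; last by rewrite tofrac_eq0 vdm_neq0.
congr tofrac; rewrite rmorph_sum; apply: eq_bigr => mu _ /=.
by rewrite map_mpolyZ map_monom_poly.
Qed.

(** Both families are unitriangular over the monomial functions, so one is solved in terms of the
    other. The pair generic, 0 gives the Kostka polynomials; the pair 0, -1 gives the Schur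
    expansion of [P_lam(-1)]. *)
Lemma hl_change_basis n (S : idomainType) (f g : {rmorphism {poly int} -> S})
    (lam : intpart n) :
  exists2 e : intpart n -> S, forall mu, ~~ dominated mu lam -> e mu = 0
  & forall m, hall_littlewood (g 'X) lam m =
      \sum_(mu | dominated mu lam)
        tofrac (mpolyC m (e mu)) * hall_littlewood (f 'X) mu m.
Proof.
have Cdom (h : {rmorphism {poly int} -> S}) (nu mu : intpart n) :
    h (hl_coef0 nu mu) != 0 -> dominated mu nu.
  by apply: contraNT => nd; rewrite /hl_coef0 (negPf nd) rmorph0.
have [|mu||e [e0 _ eE]] := @unitriangular_solve _ S (@dominated n)
    (fun nu mu => f (hl_coef0 nu mu)) (@dominated_refl n) (@dominated_anti n)
    (@dominated_trans n) _ _ lam (fun mu => g (hl_coef0 lam mu)).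
- by move=> nu mu; apply: Cdom.
- by rewrite hl_coef0_diag rmorph1.
- by move=> mu; apply: Cdom.
exists e => // m; rewrite hall_littlewood_monom.
under [RHS]eq_bigr do rewrite hall_littlewood_monom -rmorphM mul_mpolyC scaler_sumr /=.
rewrite -rmorph_sum exchange_big /=; congr tofrac; apply: eq_bigr => mu _.
by rewrite eE scaler_suml; apply: eq_bigr => nu _; rewrite scalerA.
Qed.

(** The expansion is compared in [n] variables, where the monomial functions are independent. [P]
    covers both the dominated index set of [kostka] and the full one of [schurP_coef]. *)
Lemma hl_change_basis_coef n (S : idomainType) (f g : {rmorphism {poly int} -> S})
    (lam : intpart n) (P : pred (intpart n)) (e : intpart n -> S) :
  (forall m, hall_littlewood (g 'X) lam m =
     \sum_(mu | P mu) tofrac (mpolyC m (e mu)) * hall_littlewood (f 'X) mu m) ->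
  forall nu, \sum_(mu | P mu) e mu * f (hl_coef0 mu nu) = g (hl_coef0 lam nu).
Proof.
move=> /(_ n) E nu; symmetry; move: nu; apply: monom_poly_sum_inj.
move: E; rewrite hall_littlewood_monom.
under [X in _ = X -> _]eq_bigr
  do rewrite hall_littlewood_monom -rmorphM mul_mpolyC scaler_sumr /=.
rewrite -rmorph_sum exchange_big /= => /eqP; rewrite tofrac_eq => /eqP->.
by apply: eq_bigr => mu _; rewrite scaler_suml; apply: eq_bigr => nu _; rewrite scalerA.
Qed.

Lemma kostka_hl_coef n (lam nu : intpart n) :
  \sum_(mu | dominated mu lam) kostka lam mu * hl_coef0 mu nu =
  ((hl_coef0 lam nu).[0])%:P.
Proof.
(* Evaluation at 0 that returns to [{poly int}], the ring over which [kostka] is defined. *)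
pose g : {rmorphism {poly int} -> {poly int}} := polyC \o horner_eval 0.
have gX : g 'X = 0 by rewrite /g /= horner_evalE hornerX.
have [e _ eE] := hl_change_basis idfun g lam.
rewrite -[RHS]/(g (hl_coef0 lam nu)).
apply: (hl_change_basis_coef (f := idfun) (g := g)) => m; rewrite gX -schurE.
apply: (@coordsP n _ (fun nu => dominated nu lam) (@hall_littlewood n {poly int} 'X)).
by exists e => m'; rewrite schurE -gX eE.
Qed.

Lemma schurP_coef_hl_coef n (lam nu : intpart n) :
  \sum_mu schurP_coef lam mu * (hl_coef0 mu nu).[0] = (hl_coef0 lam nu).[-1].
Proof.
pose f : {rmorphism {poly int} -> int} := horner_eval 0.
pose g : {rmorphism {poly int} -> int} := horner_eval (-1).
have fX : f 'X = 0 by rewrite /f /= horner_evalE hornerX.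
have gX : g 'X = -1 by rewrite /g /= horner_evalE hornerX.
have [e e0 eE] := hl_change_basis f g lam.
apply: (hl_change_basis_coef (f := f) (g := g) (P := predT)) => m.
rewrite gX fX; under [RHS]eq_bigr do rewrite -schurE.
apply: (@coordsP n _ predT (@schur n int)).
exists e => m'; rewrite -gX eE big_mkcond; apply: eq_bigr => mu _.
by rewrite fX schurE; case: ifPn => // /e0->; rewrite mpolyC0 rmorph0 mul0r.
Qed.

(** * The one-row function at t = 0 *)

Section Row.

Variables (n : nat) (R : idomainType) (m : nat).
Hypotheses (n_gt0 : (0 < n)%N) (m_gt0 : (0 < m)%N).

Let spike (i : 'I_m) : {ffun 'I_m -> 'I_n.+1} :=
  [ffun k => if k == i then ord_max else ord0].

Lemma rearr_row : rearr m (row_part n) = [set spike i | i : 'I_m].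
Proof.
have rowE k : nth 0%N (row_part n) k = if k == 0%N then n else 0%N.
  by rewrite /= n_gt0; case: k => //= k; rewrite nth_nil.
pose o := Ordinal m_gt0.
have oE (k : 'I_m) : (k == 0%N :> nat) = (k == o) by [].
apply/setP => a; apply/rearrP/imsetP => [[_ [s sE]]|[i _ ->]].
  exists (s^-1 o)%g => //; apply/ffunP => k; apply: val_inj.
  rewrite ffunE /= sE rowE oE -(inj_eq (@perm_inj _ s) k) permKV.
  by case: ifP.
split; first by rewrite size_nseq n_gt0.
exists (tperm i o) => k; rewrite ffunE rowE oE -{2}(tpermL i o).
by rewrite (inj_eq perm_inj); case: ifP.
Qed.

Lemma hl0_row : hall_littlewood (0 : R) (row_part n) m =
  tofrac (\sum_(a : {ffun 'I_m -> 'I_n.+1} | (\sum_i a i)%N == n) 'X_[expo a]).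
Proof.
pose x i := tofrac ('X_i : {mpoly R[m]}).
have x_inj : injective x.
  move=> i j /eqP; rewrite /x tofrac_eq => /eqP E; apply/eqP.
  by apply: contraT => /(@mpolyX_sub_neq0 R); rewrite E subrr eqxx.
have szI : size (index_enum 'I_m) = m by rewrite /index_enum -enumT size_enum_ord.
have nzI : index_enum 'I_m != [::] by rewrite -size_eq0 szI -lt0n.
(* In degree [n + m.-1] the shift by ['X^(m.-1)] leaves the coefficient of degree [n] of the
   product, the complete homogeneous function of degree [n]. *)
have := @partial_fraction_complete _ _ x x_inj n (index_enum 'I_m)
  (index_enum_uniq _) nzI (n + m.-1)%N.
rewrite szI coefXnM ltnNge leq_addl addnK => /(_ (leqnn _)) /= E.
transitivity (\sum_(i < m) x i ^+ (n + m.-1) / \prod_(j < m | j != i) (x i - x j)).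
  rewrite /hall_littlewood rearr_row big_imset /=; last first.
    move=> i j _ _ /ffunP/(_ i); rewrite !ffunE eqxx; case: eqP => // _.
    by move/(congr1 val) => /= n0; move: n_gt0; rewrite n0.
  apply: eq_bigr => i _; rewrite exprD -mulrA; congr (_ * _).
    rewrite (bigD1 i) //= ffunE eqxx rmorphXn big1 ?mulr1 // => k neq.
    by rewrite ffunE (negPf neq) expr0 rmorph1.
  rewrite (bigD1 i) //= [X in _ * X]big1 ?mulr1 => [|k neq]; last first.
    by rewrite big_pred0 // => j; rewrite [spike i k]ffunE (negPf neq) ltn0.
  have <- : \prod_(j < m | j != i) x i = x i ^+ m.-1.
    by rewrite prodr_const cardC1 card_ord.
  rewrite -prodf_div; apply: eq_big => [j|j _].
    by rewrite !ffunE eqxx; case: eqP => _; rewrite ?ltnn ?n_gt0.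
  by rewrite scale0r subr0 rmorphB.
rewrite E bigA_distr_bigA coef_sum rmorph_sum [RHS]big_mkcond /=.
apply: eq_bigr => a _; under eq_bigr do rewrite exprZn -mul_polyC.
rewrite big_split /= prodrXr -rmorph_prod coefCM coefXn eq_sym.
case: eqP => _; rewrite ?mulr0 // mulr1 mpolyXE_id rmorph_prod.
by apply: eq_bigr => i _; rewrite mnmE rmorphXn.
Qed.

End Row.

(** A vector of sum [n] is a rearrangement of exactly one partition: its positive entries,
    sorted. *)
Lemma sum_monom_poly n (R : comNzRingType) m :
  \sum_(mu : intpart n) monom_poly R mu m =
  \sum_(a : {ffun 'I_m -> 'I_n.+1} | (\sum_i a i)%N == n) 'X_[expo a].
Proof.
rewrite (exchange_big_dep predT) //= [RHS]big_mkcond; apply: eq_bigr => a _.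
case: ifP => [/eqP sum_a|/eqP sum_a]; last first.
  by rewrite big_pred0 // => mu; apply/negP => /rearr_sum.
pose u := [seq k <- [seq val (a i) | i <- enum 'I_m] | (0 < k)%N].
have uP : is_intpart n (sort geq u).
  apply/and3P; split.
  - by apply: sort_sorted => x y; apply: leq_total.
  - by rewrite all_sort; apply: filter_all.
  - have /perm_sumn-> := permEl (perm_sort geq u).
    have -> s : sumn [seq k <- s | (0 < k)%N] = sumn s.
      by elim: s => //= -[|k] s IHs //=; rewrite IHs.
    by rewrite sumnE big_map big_enum /= sum_a.
rewrite (big_pred1 (IntPart uP)) // => mu; rewrite inE -/u.
apply/idP/eqP => [pe|->]; last by rewrite perm_sym perm_sort.
apply: val_inj; apply: (sorted_eq geq_trans geq_anti) => /=.
- exact: intpart_sorted.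
- by apply: sort_sorted => x y; apply: leq_total.
- by rewrite perm_sym perm_sort.
Qed.

Lemma hl_coef0_row n (mu : intpart n) : (hl_coef0 (row_part n) mu).[0] = 1.
Proof.
have [n0|n_gt0] := posnP n.
  suff -> : mu = row_part n by rewrite hl_coef0_diag hornerC.
  apply: val_inj; have := intpart_size mu; have := intpart_size (row_part n).
  by move: mu; rewrite n0 /= leqn0 => -[[]].
pose f : {rmorphism {poly int} -> int} := horner_eval 0.
have fX : f 'X = 0 by rewrite /f /= horner_evalE hornerX.
have := hall_littlewood_monom f (row_part n) n.
rewrite fX hl0_row // -sum_monom_poly => /eqP; rewrite tofrac_eq => /eqP.
under eq_bigr do rewrite -[monom_poly _ _ _]scale1r.
by move/monom_poly_sum_inj/(_ mu).
Qed.

(** * Permutations and set partitions *)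

Section YoungSubgroup.

Variable T : finType.
Implicit Types (P : {set {set T}}) (B : {set T}) (d : {perm T}).

(** It is applied on two levels: to the blocks of a set partition of ['I_n], where its order is
    [mu!], and to the blocks grouped by size, as points of [{set 'I_n}], where its order is
    [mu^!]. *)
Definition young P : {set {perm T}} :=
  [set d | perm_on (cover P) d && [forall B in P, d @: B == B]].

Lemma youngP P d :
  reflect (perm_on (cover P) d /\ forall B, B \in P -> d @: B = B) (d \in young P).
Proof.
rewrite inE; apply: (iffP andP) => [[onP /forall_inP H]|[onP H]]; split=> //.
  by move=> B /H/eqP.
by apply/forall_inP => B /H->.
Qed.

Lemma restr_perm_stable B d : d @: B = B -> {in B, restr_perm B d =1 d}.
Proof.
move=> dB x xB; apply: restr_permE => //; apply/astabsP => y.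
change ((d y \in B) = (y \in B)); rewrite -{1}dB mem_imset //; exact: perm_inj.
Qed.

(** Splitting off a block [B] writes the group as a product of the permutations of [B] and the Young
    subgroup of the other blocks; the first factor of [d] is its restriction to [B]. *)
Lemma card_young P : trivIset P -> #|young P| = (\prod_(B in P) #|B|`!)%N.
Proof.
have [k] := ubnP #|P|; elim: k P => // k IHk P; rewrite ltnS => leP tP.
have [->|[B BP]] := set_0Vmem P.
  rewrite big_set0 -[RHS](cards1 (1%g : {perm T})); congr #|pred_of_set _|.
  apply/setP => d; rewrite [RHS]inE; apply/youngP/eqP => [[onP _]|->].
    apply/permP => x; rewrite perm1 (out_perm onP) // /cover big_set0 inE //.
  split; first by apply/subsetP => x; rewrite inE perm1 eqxx.
  by move=> B; rewrite inE.
pose P' := P :\ B.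
have PE : P = B |: P' by rewrite setD1K.
have nBP' : B \notin P' by rewrite !inE eqxx.
have dis : [disjoint B & cover P'].
  apply/bigcup_disjointP => C; rewrite !inE => /andP[neq CP].
  by have /trivIsetP := tP; apply=> //; rewrite eq_sym.
have covE : cover P = B :|: cover P'.
  by rewrite PE /cover (big_setU1 _ nBP').
have tP' : trivIset P' by apply: trivIsetS tP; apply: subD1set.
rewrite (big_setD1 B BP) /= -/P' -IHk //; last by rewrite (cardsD1 B P) BP in leP.
have onI d1 C : perm_on C d1 -> [disjoint C & B] -> d1 @: B = B.
  move=> on1 d1B; apply/setP => x; apply/imsetP/idP => [[y yB ->]|xB].
    by rewrite (out_perm on1) // (disjointFl d1B).
  by exists x => //; rewrite (out_perm on1) // (disjointFl d1B).
pose f (uv : {perm T} * {perm T}) := (uv.1 * uv.2)%g.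
have outP' B' u x : perm_on B u -> B' \in P' -> x \in B' -> u x = x.
  move=> onB B'P xB'; apply: (out_perm onB); apply: contraL xB' => xB.
  apply: contraTN dis => xB'; apply/pred0Pn; exists x => /=; rewrite xB.
  by apply/bigcupP; exists B'.
have -> : young P = f @: setX [set u | perm_on B u] (young P').
  apply/setP => d; apply/idP/imsetP => [/youngP[onP stP]|].
    pose u := restr_perm B d; have dB := stP _ BP.
    have uE := restr_perm_stable dB.
    exists (u, (u^-1 * d)%g); last by rewrite /f /= mulKVg.
    rewrite !inE /= restr_perm_on /=.
    have onB := restr_perm_on B d; have onBV := perm_onV onB.
    apply/andP; split; last first.
      apply/forall_inP => B' B'P; apply/eqP.
      have B'P1 : B' \in P by move: B'P; rewrite inE => /andP[].
      rewrite -[RHS](stP _ B'P1); apply: eq_in_imset => x xB'.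
      by rewrite permM (outP' B' _ _ onBV B'P xB').
    apply/subsetP => x; rewrite inE permM; apply: contraR => nx.
    have [xB|nxB] := boolP (x \in B).
      have uxB : (u^-1 x)%g \in B by rewrite perm_closed.
      by rewrite -uE // permKV.
    by rewrite (out_perm onBV) // (out_perm onP) // covE inE negb_or nxB.
  case=> -[u v]; rewrite in_setX => /andP[/=]; rewrite inE => onB /youngP[onP' stP'] ->.
  apply/youngP; split=> [|B' B'P].
    apply/subsetP => x; rewrite inE covE inE permM; apply: contraR.
    by rewrite negb_or => /andP[nB nP']; rewrite (out_perm onB) // (out_perm onP').
  have [E|neq] := eqVneq B' B.
    rewrite E /f /= (_ : (u * v)%g @: B = v @: (u @: B)).
      by rewrite (im_perm_on onB) (onI _ _ onP') // disjoint_sym.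
    by rewrite -imset_comp; apply: eq_imset => x; rewrite /= permM.
  have B'P' : B' \in P' by move: B'P; rewrite !inE (negPf neq).
  rewrite -[RHS](stP' _ B'P'); apply: eq_in_imset => x xB'.
  by rewrite permM (outP' B' _ _ onB B'P' xB').
rewrite card_in_imset ?cardsX; first by rewrite -(card_perm B) cardsE.
move=> [u v] [u' v']; rewrite !in_setX !inE /= => /andP[on1 /andP[on2 _]].
move=> /andP[on1' /andP[on2' _]] E.
have uu' : u = u'.
  apply/permP => x; have [xB|nxB] := boolP (x \in B); last first.
    by rewrite (out_perm on1) // (out_perm on1').
  have /permP/(_ x) := E; rewrite /f /= !permM.
  have nP y : y \in B -> y \notin cover P' by move=> yB; rewrite (disjointFr dis yB).
  by rewrite (out_perm on2) ?(out_perm on2') // nP // perm_closed.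
by move: E; rewrite /f /= uu' => /mulgI->.
Qed.

End YoungSubgroup.

Lemma perm_actM n (d e : 'S_n) P : perm_act (d * e)%g P = perm_act e (perm_act d P).
Proof.
rewrite /perm_act -imset_comp; apply: eq_imset => B /=; rewrite -imset_comp.
by apply: eq_imset => x; rewrite /= permM.
Qed.

Lemma perm_act_setpart n (d : 'S_n) (pi : setpart n) :
  partition (perm_act d pi) [set: 'I_n].
Proof.
have -> : [set: 'I_n] = d @: [set: 'I_n].
  apply/setP => x; rewrite inE; apply/esym/imsetP; exists (d^-1 x)%g => //.
  by rewrite permKV.
rewrite /perm_act imset_partition ?setpartP // => x y.
exact: perm_inj.
Qed.

Definition sp_act n (d : 'S_n) (pi : setpart n) : setpart n :=
  SetPart (perm_act_setpart d pi).

Lemma perm_eq_block_sizes n (P Q : {set {set 'I_n}}) (f : {set 'I_n} -> {set 'I_n}) :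
  {in P &, injective f} -> {in P, forall B, #|f B| = #|B|} -> f @: P = Q ->
  block_sizes P = block_sizes Q.
Proof.
move=> fI fC <-; rewrite /block_sizes.
apply/perm_sortP.
- by move=> x y; apply: leq_total.
- by move=> y x z /= le1 le2; apply: leq_trans le2 le1.
- by move=> x y; rewrite /= -eqn_leq => /eqP.
have pe : perm_eq (enum (f @: P)) [seq f B | B <- enum P].
  apply: uniq_perm; rewrite ?enum_uniq //.
    by rewrite map_inj_in_uniq ?enum_uniq // => x y; rewrite !mem_enum; apply: fI.
  move=> B; rewrite mem_enum; apply/imsetP/mapP => [[x xP ->]|[x]].
    by exists x; rewrite ?mem_enum.
  by rewrite mem_enum; exists x.
rewrite perm_sym; apply: perm_trans (perm_map _ pe) _; rewrite -map_comp.
suff /eq_in_map-> : {in enum P, (fun B : {set 'I_n} => #|f B|) =1 (fun B => #|B|)} by [].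
by move=> B; rewrite mem_enum; apply: fC.
Qed.

Lemma sp_type_act n (d : 'S_n) (pi : setpart n) : sp_type (sp_act d pi) = sp_type pi.
Proof.
apply: val_inj => /=; apply/esym.
apply: (perm_eq_block_sizes (f := fun B : {set 'I_n} => d @: B)).
- by move=> B C _ _; apply/imset_inj/perm_inj.
- by move=> B _; rewrite card_imset //; apply: perm_inj.
- by [].
Qed.

(** * Interval partitions and the permutation of a set partition *)

Definition interval n (mu : intpart n) (j : nat) : {set 'I_n} :=
  [set i : 'I_n | (sumn (take j mu) <= i < sumn (take j.+1 mu))%N].

Lemma interval_blocksE n (mu : intpart n) :
  interval_blocks mu = [set interval mu j | j : 'I_(size mu)].
Proof. by []. Qed.

Lemma sumn_takeS (s : seq nat) j :
  sumn (take j.+1 s) = (sumn (take j s) + nth 0%N s j)%N.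
Proof. by rewrite !sumn_takeE big_ord_recr. Qed.

Lemma intervalP n (mu : intpart n) j (i : 'I_n) :
  reflect (exists2 c, (c < nth 0%N mu j)%N & i = (sumn (take j mu) + c)%N :> nat)
    (i \in interval mu j).
Proof.
rewrite inE sumn_takeS; apply: (iffP andP) => [[le lt]|[c ltc ->]].
  by exists (i - sumn (take j mu))%N; [rewrite ltn_subLR | rewrite subnKC].
by rewrite leq_addr ltn_add2l.
Qed.

(** Membership becomes the value of a function of [i], which makes the intervals disjoint and
    covering. *)
Lemma interval_reshape n (mu : intpart n) j (i : 'I_n) :
  (i \in interval mu j) = (reshape_index mu i == j).
Proof.
apply/intervalP/eqP => [[c ltc iE]|<-].
  by rewrite iE -[X in reshape_index _ X]/(flatten_index mu j c) flatten_indexKl.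
exists (reshape_offset mu i); last by rewrite -[LHS](reshape_indexK mu).
by apply: reshape_offsetP; rewrite intpart_sumn.
Qed.

Lemma card_interval n (mu : intpart n) j : #|interval mu j| = nth 0%N mu j.
Proof.
rewrite -[RHS]card_ord.
have lt (c : 'I_(nth 0%N mu j)) : (sumn (take j mu) + c < n)%N.
  by rewrite -[X in (_ < X)%N](intpart_sumn mu) (@flatten_indexP mu j c).
pose f c := Ordinal (lt c).
have f_inj : injective f.
  by move=> c c' /(congr1 val) /addnI/val_inj.
rewrite -(card_imset _ f_inj); apply: eq_card => i.
apply/intervalP/imsetP => [[c ltc iE]|[c _ ->]]; last by exists c.
by exists (Ordinal ltc) => //; apply: val_inj.
Qed.

Lemma interval_inj n (mu : intpart n) j k : (j < size mu)%N ->
  interval mu j = interval mu k -> j = k.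
Proof.
rewrite -intpart_nth_gt0 -card_interval card_gt0 => /set0Pn[i ij] E.
have ik := ij; rewrite E in ik.
by move: ij ik; rewrite !interval_reshape => /eqP-> /eqP.
Qed.

Lemma interval_partition n (mu : intpart n) :
  partition (interval_blocks mu) [set: 'I_n].
Proof.
rewrite interval_blocksE; apply/and3P; split.
- apply/eqP/setP => i; rewrite inE; apply/bigcupP.
  have lt : (reshape_index mu i < size mu)%N.
    by apply: reshape_indexP; rewrite intpart_sumn.
  exists (interval mu (reshape_index mu i)); last by rewrite interval_reshape.
  by apply/imsetP; exists (Ordinal lt).
- apply/trivIsetP => A B /imsetP[j _ ->] /imsetP[k _ ->] neq.
  apply/pred0P => i /=; rewrite !interval_reshape.
  by apply/negP => /andP[/eqP Ej /eqP Ek]; rewrite -Ej -Ek eqxx in neq.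
- apply/imsetP => -[j _ /esym/eqP].
  by rewrite -cards_eq0 card_interval eqn0Ngt intpart_nth_gt0 ltn_ord.
Qed.

Definition interval_sp n (mu : intpart n) : setpart n :=
  SetPart (interval_partition mu).

Lemma sp_type_interval n (mu : intpart n) : sp_type (interval_sp mu) = mu.
Proof.
apply: val_inj => /=; apply: (sorted_eq geq_trans geq_anti).
- exact: (sort_sorted geq_total).
- exact: intpart_sorted.
rewrite /block_sizes perm_sort.
have pe : perm_eq (enum (interval_blocks mu))
    [seq interval mu j | j : 'I_(size mu) <- enum 'I_(size mu)].
  apply: uniq_perm; rewrite ?enum_uniq //.
    rewrite map_inj_in_uniq ?enum_uniq // => j k _ _ /interval_inj E.
    by apply: val_inj; apply: E.
  move=> B; rewrite mem_enum interval_blocksE.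
  by apply/imsetP/mapP => -[j jP ->]; exists j; rewrite ?mem_enum.
apply: perm_trans (perm_map _ pe) _; rewrite -map_comp.
rewrite (@eq_map _ _ _ (fun j : 'I_(size mu) => nth 0%N mu j)) => [|j]; last first.
  exact: card_interval.
by rewrite (map_comp (nth 0%N mu) val) val_enum_ord map_nth_iota0 // take_size.
Qed.

Lemma block_before_total n : total (@block_before n).
Proof.
move=> A B; rewrite /block_before; case: ltngtP => //= _.
exact: leq_total.
Qed.

Lemma block_sizes_sorted n (P : {set {set 'I_n}}) :
  block_sizes P = [seq #|B| | B : {set 'I_n} <- sort (@block_before n) (enum P)].
Proof.
apply: (sorted_eq geq_trans geq_anti).
- exact: (sort_sorted geq_total).
- have srt := sort_sorted (@block_before_total n) (enum P).
  rewrite sorted_map; apply: sub_sorted srt => A B.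
  by rewrite /block_before /= => /orP[/ltnW|/andP[/eqP->]].
- rewrite /block_sizes perm_sort perm_sym; apply: perm_map.
  by rewrite perm_sort.
Qed.

(** The one-line word concatenates the sorted blocks, so the j-th interval is carried into the j-th
    block, and onto it because the sizes agree. *)
Lemma delta_interval n (pi : setpart n) :
  sp_act (delta pi) (interval_sp (sp_type pi)) = pi.
Proof.
apply: val_inj => /=.
pose bl := sort (@block_before n) (enum pi); pose mu := sp_type pi.
have muE : mu = [seq #|B| | B : {set 'I_n} <- bl] :> seq nat by apply: block_sizes_sorted.
have szmu : size mu = size bl by rewrite muE size_map.
have shE : shape [seq enum B | B : {set 'I_n} <- bl] = mu.
  by rewrite /shape -map_comp muE; apply: eq_map => B; rewrite /= cardE.
have main j : (j < size bl)%N -> delta pi @: interval mu j = nth set0 bl j.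
  move=> ltj; have muj : nth 0%N mu j = #|nth set0 bl j|.
    by rewrite muE (nth_map set0).
  apply/eqP; rewrite eqEcard card_imset ?card_interval ?muj ?leqnn ?andbT;
    last exact: perm_inj.
  apply/subsetP => x /imsetP[i /intervalP[c ltc iE] ->].
  rewrite permE /delta_word nth_flatten -/bl shE iE.
  rewrite -[(_ + c)%N]/(flatten_index mu j c) flatten_indexKl // flatten_indexKr //.
  by rewrite (nth_map set0) // -mem_enum mem_nth // -cardE -muj.
rewrite /perm_act interval_blocksE -imset_comp.
apply/setP => B; apply/imsetP/idP => [[j _ ->]|piB].
  have ltj : (j < size bl)%N by rewrite -szmu.
  rewrite /= main // -mem_enum; have := mem_nth set0 ltj.
  by rewrite mem_sort.
have Bbl : B \in bl by rewrite mem_sort mem_enum.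
have lt : (index B bl < size mu)%N by rewrite szmu index_mem.
by exists (Ordinal lt) => //=; rewrite main ?index_mem // nth_index.
Qed.

Lemma stab_groupP n (pi : setpart n) d :
  reflect (sp_act d pi = pi) (d \in stab_group pi).
Proof.
rewrite inE; apply: (iffP eqP) => [E|E]; first exact: val_inj.
exact: congr1 E.
Qed.

(** * Order of the stabilizer of a set partition *)

Section Stabilizer.

Variables (n : nat) (pi : setpart n).

Let size_class k : {set {set 'I_n}} := [set B in pi | #|B| == k].
Let classes : {set {set {set 'I_n}}} := [set size_class #|B| | B : {set 'I_n} in pi].
(** The permutations of the blocks of [pi] that preserve block sizes. *)
Let V := young classes.

Let size_classP k B : reflect (B \in blocks pi /\ #|B| = k) (B \in size_class k).
Proof. by rewrite inE; apply: (iffP andP) => -[H /eqP]. Qed.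

Let trivIset_classes : trivIset classes.
Proof.
apply/trivIsetP => _ _ /imsetP[A _ ->] /imsetP[B _ ->] neq.
apply/pred0P => C /=; apply/negP => /andP[/size_classP[_ E1] /size_classP[_ E2]].
by rewrite -E1 -E2 eqxx in neq.
Qed.

Let cover_classes : cover classes = pi.
Proof.
apply/setP => B; apply/bigcupP/idP => [[_ /imsetP[A _ ->] /size_classP[]]|piB] //.
exists (size_class #|B|); first by apply/imsetP; exists B.
by apply/size_classP.
Qed.

Let VP (b : {perm {set 'I_n}}) :
  reflect (perm_on pi b /\ forall B, B \in blocks pi -> #|b B| = #|B|) (b \in V).
Proof.
apply: (iffP (youngP _ _)); rewrite cover_classes => -[onb H]; split=> //.
  move=> B piB; have /H/setP/(_ (b B)) : size_class #|B| \in classes.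
    by apply/imsetP; exists B.
  rewrite imset_f; last exact/size_classP.
  by move=> /esym/size_classP[].
move=> _ /imsetP[A _ ->]; apply/eqP; rewrite eqEcard card_imset ?leqnn ?andbT;
  last exact: perm_inj.
apply/subsetP => _ /imsetP[B /size_classP[piB EB] ->].
by apply/size_classP; rewrite (perm_closed _ onb) H.
Qed.

Lemma card_size_perms : #|V| = mult_fact (sp_type pi).
Proof.
rewrite /V card_young // /mult_fact.
have cl_inj : {in undup (sp_type pi) &, injective size_class}.
  move=> k l; rewrite !mem_undup mem_sort => /mapP[B]; rewrite mem_enum => piB ->.
  move=> _ /setP/(_ B); rewrite !inE piB eqxx /= => /esym/eqP //.
transitivity (\prod_(C <- [seq size_class k | k <- undup (sp_type pi)]) #|C|`!)%N.
  rewrite [RHS]big_uniq /=; last by rewrite map_inj_in_uniq ?undup_uniq.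
  apply: eq_bigl => C; apply/imsetP/mapP => [[B piB ->]|[k]].
    exists #|B| => //; rewrite mem_undup mem_sort.
    by apply/mapP; exists B; rewrite ?mem_enum.
  rewrite mem_undup mem_sort => /mapP[B]; rewrite mem_enum => piB -> ->.
  by exists B.
rewrite big_map; apply: eq_bigr => k _; congr (_`!).
rewrite /= /block_sizes count_sort count_map -sum1_count big_enum_cond.
by rewrite -sum1_card; apply: eq_bigl => B; rewrite inE.
Qed.

Lemma card_young_blocks : #|young pi| = prod_fact (sp_type pi).
Proof.
rewrite card_young; last exact: partition_trivIset (setpartP pi).
rewrite /prod_fact /= /block_sizes.
have /(perm_big _)-> := permEl (perm_sort geq [seq #|B| | B : {set 'I_n} <- enum pi]).
by rewrite big_map big_enum.
Qed.

Let pblockP x : (pblock pi x \in blocks pi) * (x \in pblock pi x).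
Proof.
have xc : x \in cover pi by rewrite (cover_partition (setpartP pi)) inE.
by rewrite pblock_mem // mem_pblock.
Qed.

Let block_eq A B x :
  A \in blocks pi -> B \in blocks pi -> x \in A -> x \in B -> A = B.
Proof.
have tI := partition_trivIset (setpartP pi).
by move=> piA piB xA xB; rewrite -(def_pblock tI piA xA) (def_pblock tI piB xB).
Qed.

(** Each point is sent to the point of the same rank in the image block. *)
Let lift_size_perm b : b \in V ->
  exists d : 'S_n, forall B, B \in blocks pi -> d @: B = b B.
Proof.
case/VP => onb bC; pose bl x := pblock pi x.
pose f x := nth x (enum (b (bl x))) (index x (enum (bl x))).
have idx x : (index x (enum (bl x)) < size (enum (b (bl x))))%N.
  by rewrite -!cardE bC ?pblockP // cardE index_mem mem_enum pblockP.
have fb x : f x \in b (bl x) by rewrite -mem_enum mem_nth.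
have f_inj : injective f.
  move=> x y E; have bxy : bl x = bl y.
    apply: (@perm_inj _ b); apply: (@block_eq _ _ (f x)); rewrite ?fb //.
    - by rewrite (perm_closed _ onb) pblockP.
    - by rewrite (perm_closed _ onb) pblockP.
    - by rewrite E fb.
  have : index x (enum (bl x)) = index y (enum (bl y)).
    have := E; rewrite /f (set_nth_default x y) // -bxy => /eqP.
    have idy := idx y; rewrite -bxy in idy.
    by rewrite nth_uniq ?enum_uniq // => /eqP.
  rewrite -bxy => /(congr1 (nth x (enum (bl x)))).
  by rewrite !nth_index // mem_enum ?pblockP // bxy pblockP.
exists (perm f_inj) => B piB; apply/eqP; rewrite eqEcard bC // card_imset ?leqnn ?andbT;
  last exact: perm_inj.
apply/subsetP => _ /imsetP[x xB ->]; rewrite permE.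
have <- : bl x = B by apply: (@block_eq _ _ x); rewrite ?pblockP.
exact: fb.
Qed.

Let block_perm (d : 'S_n) : {perm {set 'I_n}} :=
  restr_perm pi (perm (imset_inj (@perm_inj _ d))).

Let block_permE d B : d \in stab_group pi -> B \in blocks pi -> block_perm d B = d @: B.
Proof.
move=> /stab_groupP/(congr1 val) /= E piB; rewrite /block_perm restr_perm_stable ?permE //.
by rewrite -[RHS]E; apply: eq_imset => A; rewrite permE.
Qed.

Let block_perm_size d : d \in stab_group pi -> block_perm d \in V.
Proof.
move=> std; apply/VP; split=> [|B piB]; first exact: restr_perm_on.
by rewrite block_permE // card_imset //; apply: perm_inj.
Qed.

(** The action on blocks maps the stabilizer onto [V], and the fibre over [b] is the coset of
    [young pi] through a lift [d0] of [b]. *)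
Lemma card_stab_group :
  #|stab_group pi| = (mult_fact (sp_type pi) * prod_fact (sp_type pi))%N.
Proof.
rewrite -card_size_perms -card_young_blocks -sum1_card.
rewrite (partition_big block_perm (mem V)) /=; last exact: block_perm_size.
rewrite -sum_nat_const; apply: eq_bigr => b Vb; rewrite sum1_card.
have [d0 d0E] := lift_size_perm Vb; have [onb bC] := VP _ Vb.
rewrite -[RHS](card_imset _ (mulIg d0)); apply: eq_card => d.
have imM (e1 e2 : 'S_n) (B : {set 'I_n}) : (e1 * e2)%g @: B = e2 @: (e1 @: B).
  by rewrite -imset_comp; apply: eq_imset => x; rewrite /= permM.
apply/idP/imsetP => [/andP[std /eqP bd]|[k /youngP[_ kB] ->]].
  exists (d * d0^-1)%g; last by rewrite mulgKV.
  apply/youngP; split=> [|B piB].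
    by apply/subsetP => x _; rewrite (cover_partition (setpartP pi)) inE.
  rewrite imM -(block_permE std piB) bd -d0E // -imM mulgV -[RHS]imset_id.
  by apply: eq_imset => x; rewrite perm1.
have kd0 B : B \in blocks pi -> (k * d0)%g @: B = b B.
  by move=> piB; rewrite imM kB // d0E.
have std : (k * d0)%g \in stab_group pi.
  by rewrite inE /perm_act (eq_in_imset kd0) (im_perm_on onb).
apply/andP; split=> //; apply/eqP/permP => B.
have [piB|npiB] := boolP (B \in blocks pi); first by rewrite block_permE // kd0.
by rewrite (out_perm onb) // (out_perm (restr_perm_on _ _)).
Qed.

End Stabilizer.

Lemma sp_actM n (d e : 'S_n) (pi : setpart n) :
  sp_act (d * e)%g pi = sp_act e (sp_act d pi).
Proof. by apply: val_inj; apply: perm_actM. Qed.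

(** These permutations form a coset of the stabilizer: each is [delta pi] followed by an element of
    it, products applying their left factor first. *)
Lemma card_sp_act_fiber n (mu : intpart n) (pi : setpart n) : sp_type pi = mu ->
  #|[set d : 'S_n | sp_act d (interval_sp mu) == pi]| = (mult_fact mu * prod_fact mu)%N.
Proof.
move=> <-; rewrite -card_stab_group -[RHS](card_imset _ (mulgI (delta pi))).
apply: eq_card => d; rewrite inE; apply/eqP/imsetP => [E|[g /stab_groupP gP ->]].
  exists ((delta pi)^-1 * d)%g; last by rewrite mulKVg.
  apply/stab_groupP; have dI := delta_interval pi; move: dI.
  by move: (delta pi) => e eI; rewrite -{1}eI -sp_actM mulKVg E.
by rewrite sp_actM delta_interval.
Qed.

Lemma nc_act_m (A : nzRingType) n (g : 'S_n) (P : {set {set 'I_n}}) (w : word n) :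
  nc_act g (nc_m A P) w = nc_m A (perm_act g P) w.
Proof.
have sbE a b : same_block (perm_act g P) (g a) (g b) = same_block P a b.
  rewrite /perm_act; apply/exists_inP/exists_inP => [[_ /imsetP[B PB ->]]|[B PB aB]].
    by rewrite !mem_imset; try exact: perm_inj; exists B.
  exists (g @: B); first exact: imset_f.
  by rewrite !mem_imset //; apply: perm_inj.
rewrite /nc_act /nc_m; congr (if _ then _ else _).
apply/forallP/forallP => H a; apply/forallP => b.
  have /forallP/(_ (g^-1 b)%g) := H (g^-1 a)%g.
  by rewrite !ffunE !permKV -sbE !permKV.
have /forallP/(_ (g b)) := H (g a).
by rewrite !ffunE sbE.
Qed.

(** One sum over all of ['S_n] is grouped twice: by the image of the interval partition of [lam],
    which yields the left side, and by that of [mu], where each fibre has [mu^! mu!] elements. *)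
Lemma sum_stab_group_nc_m (A : nzRingType) n (lam mu : intpart n) (w : word n) :
  \sum_(pi : setpart n | sp_type pi == lam) \sum_(g in stab_group pi)
     nc_act g (nc_m A (perm_act (delta pi) (interval_blocks mu))) w =
  (mult_fact mu * prod_fact mu)%:R *
  \sum_(sigma : setpart n | sp_type sigma == mu) nc_m A sigma w.
Proof.
transitivity (\sum_(d : 'S_n) nc_m A (perm_act d (interval_blocks mu)) w).
  rewrite [RHS](partition_big (fun d => sp_act d (interval_sp lam))
    (fun pi => sp_type pi == lam)) /=; last first.
    by move=> d _; rewrite sp_type_act sp_type_interval.
  apply: eq_bigr => pi /eqP piE.
  rewrite [RHS](reindex_inj (mulgI (delta pi))) /=; apply: eq_big => [g|g _].
    rewrite sp_actM -piE delta_interval.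
    by apply/stab_groupP/eqP.
  by rewrite nc_act_m -perm_actM.
rewrite mulr_sumr (partition_big (fun d => sp_act d (interval_sp mu))
    (fun sigma => sp_type sigma == mu)) /=; last first.
  by move=> d _; rewrite sp_type_act sp_type_interval.
apply: eq_bigr => sigma /eqP/card_sp_act_fiber <-.
rewrite -sum1_card natr_sum mulr_suml; apply: eq_big => [d|d /eqP <-].
  by rewrite inE.
by rewrite mul1r.
Qed.

(** * Lifted functions *)

(** The factor [mult_fact mu] of the count cancels the denominator in [nc_HL], and [prod_fact mu]
    remains. *)
Lemma lifted_HL_sum n (lam : intpart n) (w : word n) :
  lifted_HL lam w = \sum_(pi : setpart n | sp_type pi == lam) nc_HL pi w.
Proof.
pose S mu := \sum_(sigma : setpart n | sp_type sigma == mu) nc_m {poly rat} sigma w.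
transitivity (\sum_(pi : setpart n | sp_type pi == lam)
    \sum_(mu | dominated mu lam)
     ((mult_fact mu)%:R^-1 *: polyQ (hl_coef lam mu)) * \sum_(g in stab_group pi)
        nc_act g (nc_m {poly rat} (perm_act (delta pi) (interval_blocks mu))) w).
  rewrite exchange_big /=; apply: eq_bigr => mu _.
  rewrite -mulr_sumr sum_stab_group_nc_m mulrA; congr (_ * _).
  rewrite mulr_natr -scaler_nat scalerA natrM mulrAC mulfV ?mul1r //.
  rewrite Num.Theory.pnatr_eq0 -lt0n /mult_fact prodn_gt0 // => k.
  exact: fact_gt0.
by apply: eq_bigr => pi /eqP <-.
Qed.

(** The coefficient at [w] of the lift of the monomial symmetric function [m_mu]. *)
Definition type_sum n (w : word n) (mu : intpart n) : rat :=
  (prod_fact mu)%:R * \sum_(sigma : setpart n | sp_type sigma == mu) nc_m rat sigma w.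

Lemma lifted_HL_type_sum n (lam : intpart n) (w : word n) :
  lifted_HL lam w = \sum_mu polyQ (hl_coef0 lam mu) * (type_sum w mu)%:P.
Proof.
rewrite /lifted_HL big_mkcond; apply: eq_bigr => mu _; rewrite /hl_coef0.
case: ifP => _; last by rewrite /polyQ rmorph0 mul0r.
rewrite /type_sum -scalerAl scalerAr polyCM mul_polyC; congr (_ * (_ *: _)).
rewrite rmorph_sum; apply: eq_bigr => sigma _.
by rewrite /nc_m; case: ifP; rewrite ?rmorph1 ?rmorph0.
Qed.

Lemma polyQ_horner (p : {poly int}) (a : int) : (polyQ p).[a%:~R] = (p.[a])%:~R.
Proof. exact: horner_map. Qed.

Lemma lifted_HL_at n (lam : intpart n) (a : int) (w : word n) :
  nc_at (lifted_HL lam) a%:~R w =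
  \sum_mu (hl_coef0 lam mu).[a]%:~R * type_sum w mu.
Proof.
rewrite /nc_at lifted_HL_type_sum horner_sum; apply: eq_bigr => mu _.
by rewrite hornerM polyQ_horner hornerC.
Qed.

Lemma lifted_schurE n (lam : intpart n) (w : word n) :
  lifted_schur lam w = \sum_mu (hl_coef0 lam mu).[0]%:~R * type_sum w mu.
Proof. by rewrite /lifted_schur -(lifted_HL_at lam 0). Qed.

(** An identity of polynomials in [t] with a constant left side: by [kostka_hl_coef] the dependence
    on [t] cancels at each monomial coefficient. *)
Lemma lifted_schur_kostka n (lam : intpart n) (w : word n) :
  (lifted_schur lam w)%:P =
  \sum_(mu | dominated mu lam) polyQ (kostka lam mu) * lifted_HL mu w.
Proof.
rewrite lifted_schurE rmorph_sum /=.
under [RHS]eq_bigr do rewrite lifted_HL_type_sum mulr_sumr.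
rewrite exchange_big /=; apply: eq_bigr => nu _.
under eq_bigr do rewrite mulrA.
rewrite -mulr_suml polyCM; congr (_ * _).
transitivity (polyQ ((hl_coef0 lam nu).[0])%:P); first by rewrite /polyQ map_polyC.
rewrite -kostka_hl_coef /polyQ rmorph_sum; apply: eq_bigr => mu _.
exact: rmorphM.
Qed.

Lemma lifted_HL_schurP n (lam : intpart n) (w : word n) :
  nc_at (lifted_HL lam) (-1) w =
  \sum_mu (schurP_coef lam mu)%:~R * lifted_schur mu w.
Proof.
have -> : (-1 : rat) = (-1 : int)%:~R by rewrite rmorphN1.
rewrite lifted_HL_at.
under [RHS]eq_bigr do rewrite lifted_schurE mulr_sumr.
rewrite exchange_big /=; apply: eq_bigr => nu _.
rewrite -schurP_coef_hl_coef rmorph_sum mulr_suml; apply: eq_bigr => mu _.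
by rewrite rmorphM mulrA.
Qed.

Lemma sp_meet_one_block n (sigma : setpart n) : sp_meet sigma (one_block n) = sigma.
Proof.
apply/setP => C; rewrite !inE; apply/andP/idP => [[nz /imset2P[A B sA]]|sC].
  by rewrite !inE => /andP[_ /eqP->]; rewrite setIT => ->.
have nz : C != set0 := partition_neq0 (setpartP sigma) sC.
split=> //; apply/imset2P; exists C [set: 'I_n]; rewrite ?setIT //.
(* The nonempty block [C] rules out [n = 0], where [one_block n] would be empty. *)
rewrite !inE eqxx andbT; apply: contraNneq nz => T0.
by rewrite -subset0 -T0 subsetT.
Qed.

(** All monomial coefficients are 1 here, and meeting with a single block changes nothing, so both
    sides weight [m_sigma] by [sigma!]. *)
Lemma lifted_schur_row n (w : word n) :
  lifted_schur (row_part n) w = nc_h rat (one_block n) w.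
Proof.
rewrite lifted_schurE /nc_h [RHS](partition_big (@sp_type n) predT) //=.
apply: eq_bigr => mu _; rewrite hl_coef0_row mul1r /type_sum mulr_sumr.
by apply: eq_bigr => sigma /eqP <-; rewrite sp_meet_one_block.
Qed.

Lemma dominated_col n (mu : intpart n) : dominated mu (col_part n) = (mu == col_part n).
Proof.
apply/idP/eqP => [/dominatedP/(_ 1%N)|->]; last exact: dominated_refl.
rewrite !big_ord1 => le1; apply: val_inj => /=.
have mu1 : all (pred1 1%N) mu.
  apply/(all_nthP 0%N) => i lti; rewrite /= eqn_leq intpart_nth_gt0 lti andbT.
  apply: leq_trans (intpart_nth_leq mu (leq0n i)) _; apply: leq_trans le1 _.
  by rewrite /= nth_nseq; case: ifP.
move/all_pred1P: mu1 => muE; rewrite muE; congr nseq.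
by have := intpart_sumn mu; rewrite muE sumn_nseq mul1n size_nseq.
Qed.

Lemma col_blocks n (sigma : setpart n) : sp_type sigma = col_part n ->
  blocks sigma = [set B : {set 'I_n} | #|B| == 1%N].
Proof.
move=> /(congr1 val) /= sE.
have card1 B : B \in blocks sigma -> #|B| = 1%N.
  move=> sB; have : #|B| \in block_sizes sigma.
    by rewrite mem_sort; apply/mapP; exists B; rewrite ?mem_enum.
  by rewrite sE mem_nseq => /andP[_ /eqP].
apply/setP => B; rewrite inE; apply/idP/idP => [/card1->//|/cards1P[x ->]].
have xc : x \in cover sigma by rewrite (cover_partition (setpartP sigma)) inE.
have sx : pblock sigma x \in blocks sigma by rewrite pblock_mem.
have /eqP/cards1P[y yE] := card1 _ sx.
by move: sx (xc); rewrite -mem_pblock yE inE => + /eqP->.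
Qed.

(** Only [(1^n)] lies below itself in dominance, and its only set partition is the one into
    singletons, whose monomial function runs over the words with distinct letters. *)
Lemma lifted_schur_col n (w : word n) :
  lifted_schur (col_part n) w = nc_e rat (one_block n) w.
Proof.
rewrite lifted_schurE (bigD1 (col_part n)) //= big1 ?addr0 => [|mu neq]; last first.
  by rewrite /hl_coef0 dominated_col (negPf neq) horner0 mul0r.
rewrite hl_coef0_diag hornerC mul1r /type_sum (_ : prod_fact _ = 1%N) ?mul1r;
  last first.
  by rewrite /prod_fact big1_seq // => k /andP[_]; rewrite mem_nseq => /andP[_ /eqP->].
rewrite (big_pred1 (interval_sp (col_part n))) => [|sigma]; last first.
  apply/eqP/eqP => [tE|->]; last exact: sp_type_interval.
  by apply: val_inj; rewrite /= (col_blocks tE) -(col_blocks (sp_type_interval _)).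
rewrite /nc_m /nc_e; congr (if _ then _ else _).
have sbE a b : same_block (interval_sp (col_part n)) a b = (a == b).
  rewrite /same_block (col_blocks (sp_type_interval _)).
  apply/exists_inP/eqP => [[B]|->].
    by rewrite inE => /cards1P[x ->] /andP[]; rewrite !inE => /eqP-> /eqP->.
  by exists [set b]; rewrite !inE ?cards1 ?eqxx.
have obE a b : same_block (one_block n) a b.
  apply/exists_inP; exists [set: 'I_n]; rewrite !inE // eqxx andbT.
  by apply/set0Pn; exists a.
apply: eq_forallb => a; apply: eq_forallb => b; rewrite sbE obE andbT.
by have [->|] := eqVneq a b; rewrite ?eqxx //= eqbF_neg.
Qed.

Theorem theorem3p2 (n : nat) :
  (forall (lam : intpart n) (w : word n),
    [/\ lifted_HL lam w =
          \sum_(pi : setpart n | sp_type pi == lam) nc_HL pi w,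
        lifted_schur lam w =
          \sum_(pi : setpart n | sp_type pi == lam) nc_schur pi w
      & (lifted_schur lam w)%:P =
          \sum_(mu : intpart n | dominated mu lam)
            \sum_(pi : setpart n | sp_type pi == mu)
              polyQ (kostka lam mu) * nc_HL pi w])
  /\ (forall w : word n,
        lifted_schur (row_part n) w = nc_h rat (one_block n) w)
  /\ (forall w : word n,
        lifted_schur (col_part n) w = nc_e rat (one_block n) w)
  /\ (forall (lam : intpart n) (w : word n), uniq lam ->
        nc_at (lifted_HL lam) (-1) w =
          \sum_(pi : setpart n | sp_type pi == lam) nc_at (nc_HL pi) (-1) w
        /\ nc_at (lifted_HL lam) (-1) w =
          \sum_(mu : intpart n) (schurP_coef lam mu)%:~R * lifted_schur mu w).
Proof.
have atE (lam : intpart n) (a : rat) w : nc_at (lifted_HL lam) a w =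
    \sum_(pi : setpart n | sp_type pi == lam) nc_at (nc_HL pi) a w.
  by rewrite /nc_at lifted_HL_sum horner_sum.
split=> [lam w|]; last first.
  split; first exact: lifted_schur_row.
  split; first exact: lifted_schur_col.
  by move=> lam w _; split; [apply: atE | apply: lifted_HL_schurP].
split; [exact: lifted_HL_sum | exact: atE |].
rewrite lifted_schur_kostka; apply: eq_bigr => mu _.
by rewrite lifted_HL_sum mulr_sumr.
Qed.
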